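(* Let $f\in\mathcal F(\mathbb R^n)$ and let $H,E$ be linear subspaces of $\mathbb R^n$ with $\dim H=i$, $\dim E=j$, where $i,j\in\{2,\dots,n-1\}$, $i+j\ge n+1$, and $H^\perp\subset E$. Put $k=i+j-n$, so that $1\le k\le n-2$. Then $$\int_EP_Ef(x)\,dx\int_Hf(y)\,dy\le\binom{n-k}{n-i}\,\sup_{x_0\in H^\perp}\int_{x_0+E\cap H}P_Ef(w)\,dw\,\int_{\mathbb R^n}f(z)\,dz .$$
   Context: $\mathcal F(\mathbb R^n)$ is the set of integrable log-concave functions $f:\mathbb R^n\to[0,\infty)$, i.e. $f((1-\lambda)x+\lambda y)\ge f(x)^{1-\lambda}f(y)^\lambda$ for all $x,y\in\mathbb R^n$, $\lambda\in[0,1]$. For a linear subspace $E$, $P_Ef(x)=\sup\{f(y):y\in x+E^\perp\}$ for $x\in E$. Integrals over (affine) subspaces are with respect to Lebesgue measure of the corresponding dimension. Note that $x_0+E\cap H\subset E$ when $x_0\in H^\perp\subset E$. *)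

(* Defs.v *)
From HB Require Import structures.
From mathcomp Require Import all_boot all_order all_algebra.
From mathcomp Require Import all_classical all_reals all_analysis.

Set Implicit Arguments.
Unset Strict Implicit.
Unset Printing Implicit Defensive.
Import Order.TTheory GRing.Theory Num.Theory.
Import numFieldNormedType.Exports.

Local Open Scope classical_set_scope.
Local Open Scope ring_scope.

(* The library has no Lebesgue measure on R^n: it is built on n-tuples as the
   n-fold product of the one-dimensional [lebesgue_measure] (Borel
   sigma-algebra) and then completed. *)
Section borel_lebesgue_measure.
Context {R : realType}.

Definition tuple_cons n (p : measurableTypeR R * n.-tuple (measurableTypeR R)) :
  n.+1.-tuple (measurableTypeR R) := [tuple of p.1 :: p.2].

Lemma measurable_tuple_cons n : measurable_fun [set: _] (@tuple_cons n).
Proof. exact: measurable_cons measurable_fst measurable_snd. Qed.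

Section step.
Variables (n : nat)
  (m : {sigma_finite_measure set (n.-tuple (measurableTypeR R)) -> \bar R}).

Definition lebesgue_cons : set (n.+1.-tuple (measurableTypeR R)) -> \bar R :=
  pushforward (lebesgue_measure \x m)%E (@tuple_cons n).

Let lebesgue_cons_measure : {measure set (n.+1.-tuple _) -> \bar R} :=
  @measure_function_pushforward__canonical__measure_function_Measure
    _ _ _ _ _ (lebesgue_measure \x m)%E _ (@measurable_tuple_cons n).

HB.instance Definition _ := isMeasure.Build _ _ _ lebesgue_cons
  (@measure0 _ _ _ lebesgue_cons_measure)
  (@measure_ge0 _ _ _ lebesgue_cons_measure)
  (@measure_semi_sigma_additive _ _ _ lebesgue_cons_measure).

Let lebesgue_cons_sigma_finite : sigma_finite [set: _] lebesgue_cons.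
Proof.
have /sigma_finiteP[F [FT ndF Foo]] :=
  sigma_finiteT (@lebesgue_measure R).
have /sigma_finiteP[G [GT ndG Goo]] := sigma_finiteT m.
pose uncons (t : n.+1.-tuple (measurableTypeR R)) :
  measurableTypeR R * n.-tuple (measurableTypeR R) :=
  (thead t, [tuple of behead t]).
have unconsK : cancel (@tuple_cons n) uncons.
  by case=> x t; congr pair; apply/val_inj.
exists (fun k => uncons @^-1` (F k `*` G k)).
  apply/esym/seteqP; split => // t _.
  have [k _ Fk] : (\bigcup_k F k) (uncons t).1 by rewrite -FT.
  have [l _ Gl] : (\bigcup_k G k) (uncons t).2 by rewrite -GT.
  exists (maxn k l) => //; split.
  - by move: Fk; exact/subsetPset/ndF/leq_maxl.
  - by move: Gl; exact/subsetPset/ndG/leq_maxr.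
move=> k; have [mF Fk] := Foo k; have [mG Gk] := Goo k; split; last first.
  rewrite /lebesgue_cons /pushforward -comp_preimage.
  rewrite (_ : uncons \o _ = id); last by apply/funext => p; exact: unconsK.
  by rewrite preimage_id product_measure1E// lte_mul_pinfty// ge0_fin_numE.
have muncons : measurable_fun [set: _] uncons.
  apply: measurable_fun_pair; first exact: measurable_tnth.
  exact: measurable_behead.
by rewrite -[X in measurable X]setTI; apply: muncons => //; exact: measurableX.
Qed.

HB.instance Definition _ :=
  Measure_isSigmaFinite.Build _ _ _ lebesgue_cons lebesgue_cons_sigma_finite.

End step.

Fixpoint borel_lebesgue n :
    {sigma_finite_measure set (n.-tuple (measurableTypeR R)) -> \bar R} :=
  if n is n'.+1 then lebesgue_cons (borel_lebesgue n')
  else \d_([tuple] : 0.-tuple (measurableTypeR R)).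

End borel_lebesgue_measure.

(* The domain of [lebesgue n] is the type of n-tuples equipped with the
   sigma-algebra of all Lebesgue measurable sets (Caratheodory completion): a
   log-concave function need not be Borel measurable. *)
Definition lebesgue {R : realType} (n : nat) : set _ -> \bar R :=
  @completed_measure_extension _ _ _ (@borel_lebesgue R n).
Arguments lebesgue {R} n _.

HB.instance Definition _ (R : realType) n := Measure.on (@lebesgue R n).

Lemma lebesgue_sigma_finite (R : realType) n :
  sigma_finite [set: _] (@lebesgue R n).
Proof. exact: completed_measure_extension_sigma_finite. Qed.

HB.instance Definition _ (R : realType) n :=
  Measure_isSigmaFinite.Build _ _ _ (@lebesgue R n) (lebesgue_sigma_finite R n).

Section log_concave_functions.
Context {R : realType} {n : nat}.
Implicit Types (f : 'rV[R]_n -> R) (g : 'rV[R]_n -> \bar R).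

Definition row_of_tuple (t : n.-tuple R) : 'rV[R]_n := \row_i tnth t i.

Definition integralRn g : \bar R := (\int[lebesgue n]_t g (row_of_tuple t))%E.

Definition integrableRn f : Prop :=
  (lebesgue n).-integrable [set: _] (fun t => (f (row_of_tuple t))%:E).

(* [powR] satisfies 0 `^ 0 = 1, and 0 `^ a = 0 for a != 0. *)
Definition log_concave f : Prop :=
  (forall x, 0 <= f x) /\
  forall (x y : 'rV[R]_n) (l : R), 0 <= l <= 1 ->
    f x `^ (1 - l) * f y `^ l <= f ((1 - l) *: x + l *: y).

Definition dot (u v : 'rV[R]_n) : R := (u *m v^T) 0 0.

Definition orthogonal_complement (E : {vspace 'rV[R]_n}) : set 'rV[R]_n :=
  [set u | forall v, v \in E -> dot u v = 0].

(* The supremum is taken in \bar R; only the values at points of E matter. *)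
Definition projection f (E : {vspace 'rV[R]_n}) (x : 'rV[R]_n) : \bar R :=
  ereal_sup [set (f y)%:E | y in [set y | orthogonal_complement E (y - x)]].

Definition gram (E : {vspace 'rV[R]_n}) : 'M[R]_(\dim E) :=
  \matrix_(i, j) dot (vbasis E)`_i (vbasis E)`_j.

Definition affine_param (x0 : 'rV[R]_n) (E : {vspace 'rV[R]_n})
    (t : 'rV[R]_(\dim E)) : 'rV[R]_n :=
  x0 + \sum_(i < \dim E) t 0 i *: (vbasis E)`_i.

End log_concave_functions.

(* Integral of g over the affine subspace x0 + E with respect to its Lebesgue
   measure of dimension \dim E. It is computed in coordinates in a basis of E;
   sqrt (det (gram E)) is the (\dim E)-dimensional volume of the parallelepiped
   spanned by this basis, so that the result is the one given by any
   orthonormal basis of E. *)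
Definition integral_affine {R : realType} {n : nat} (x0 : 'rV[R]_n)
    (E : {vspace 'rV[R]_n}) (g : 'rV[R]_n -> \bar R) : \bar R :=
  ((Num.sqrt (\det (gram E)))%:E *
   integralRn (fun t : 'rV[R]_(\dim E) => g (affine_param x0 t)))%E.

(* Main.v *)
Require Import Defs.
From HB Require Import structures.
From mathcomp Require Import all_boot all_order all_algebra.
From mathcomp Require Import all_classical all_reals all_analysis.
From mathcomp Require Import measurable_realfun.
From mathcomp Require Import ring lra zify.

(* Write R^n as the orthogonal sum of A = H^perp, B = E :&: H and C = E^perp, of
   dimensions a = n - i, k and c = n - j, and let F (x, b) = sup_z f (x, b, z).
   Replace f on each fibre (x, b) + C by its decreasing rearrangement in the
   volume v; integrating over b gives N (x, v), with N (x, 0) = G x the integral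
   of F (x, _) over B, hence N <= M := sup G.  Log-concavity
   bounds f ((1 - l) p + l q) below by f p ^ (1 - l) * f q ^ l for p in H and q
   in (x, b) + C, and scaling in C turns this into the hypothesis of the
   Prekopa-Leindler inequality on B, whence
     N (l x, (1 - l)^c v) >= min (N (0, v)) (G x).
   So, at each level t, if N (0, v) > t then the set {N (_, w) > t} contains
   {G > t} shrunk by 1 - (w / v)^(1/c); by the beta integral the region {N > t}
   has volume at least |{v : N (0, v) > t}| |{G > t}| / 'C(a + c, a).  Integrate
   over t and use Chebyshev's inequality on [0, M] for these two decreasing
   functions of t: their integrals are those of f over H and of P_E f over E. *)

Set Implicit Arguments.
Unset Strict Implicit.
Unset Printing Implicit Defensive.
Import Order.TTheory GRing.Theory Num.Theory.
Import numFieldNormedType.Exports.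

Local Open Scope classical_set_scope.
Local Open Scope ring_scope.

(** * Layer cake formula *)

(** Measurability and null sets shape the argument. [P_E f] is an uncountable supremum, and H is a
    null set of R^n, so a Borel majorant of [f] with the same integral says nothing about [f] on H.
    Hence three separate Borel functions: minorants of [P_E f] on E and of [f] on H, which are
    enough because these integrals stand on the smaller side, and a majorant of [f] for the larger
    side. Only a pointwise inequality linking the three is used, so the profile at x = 0 becomes a
    function of its own. Values may be infinite, and inequalities are therefore tested on real
    numbers strictly below them. The profile at x = 0 stays below M because a rearrangement never
    exceeds the supremum over its fibre, so that its integral over b is at most that of [P_E f] over
    B. Both distribution functions in the Chebyshev step thus vanish above M, whence the single
    factor M. *)

Section level_measure.
Local Open Scope ereal_scope.
Context {R : realType}.
Notation RR := (measurableTypeR R).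
Notation lam := (@lebesgue_measure R).

(* The condition [0 < t] lets the layer cake formula integrate over all of [R]. *)
Definition level_measure d (X : measurableType d) (m : set X -> \bar R)
    (g : X -> \bar R) (t : R) : \bar R :=
  m [set x | (0 < t)%R /\ t%:E < g x].

Lemma measurable_subgraph d (X : measurableType d) (g : X -> \bar R) :
  measurable_fun [set: X] g ->
  measurable [set p : X * RR | (0 < p.2)%R /\ p.2%:E < g p.1].
Proof.
move=> mg.
have -> : [set p : X * RR | (0 < p.2)%R /\ p.2%:E < g p.1] =
  setT `&` [set p : X * RR | 0 < p.2%:E] `&` (setT `&` [set p : X * RR | p.2%:E < g p.1]).
  by apply/seteqP; split => p /=; rewrite lte_fin; intuition.
have msnd : measurable_fun [set: X * RR] (fun p : X * RR => p.2%:E).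
  by apply/measurable_EFinP; exact: measurable_snd.
apply: measurableI; apply: measurable_lte => //.
by apply: measurableT_comp => //; exact: measurable_fst.
Qed.

Lemma measurable_level_set d (X : measurableType d) (g : X -> \bar R) t :
  measurable_fun [set: X] g -> measurable [set x | (0 < t)%R /\ t%:E < g x].
Proof.
move=> mg; have := measurable_ysection (t : RR) (measurable_subgraph mg).
by rewrite /ysection/=; under eq_set do rewrite in_setE.
Qed.

(** Tonelli for the indicator of the subgraph: its section over [x] is an interval of length [g x],
    unbounded when [g x] is infinite. *)
Lemma integral_level_measure d (X : measurableType d)
    (m : {sigma_finite_measure set X -> \bar R}) (g : X -> \bar R) :
  measurable_fun [set: X] g -> (forall x, 0 <= g x) ->
  \int[m]_x g x = \int[lam]_t level_measure m g t.
Proof.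
move=> mg g0; set S := [set p : X * RR | (0 < p.2)%R /\ p.2%:E < g p.1].
have mS : measurable S by exact: measurable_subgraph.
transitivity (\int[m]_x \int[lam]_t (\1_S (x, t))%:E).
  apply: eq_integral => x _.
  rewrite -[LHS]/(g x).
  have -> : (fun t => (\1_S (x, t) : R)%:E) = (fun t => (\1_(xsection S x) t)%:E).
    by apply/funext => t; rewrite !indicE mem_xsection.
  rewrite integral_indic//; last exact: measurable_xsection.
  rewrite setIT; have := g0 x; case E : (g x) => [r| |//] r0.
    have -> : xsection S x = `]0%R, r[%classic.
      apply/seteqP; split => t; rewrite /xsection /= inE /S /= E lte_fin in_itv/=.
        by move=> [-> ->].
      by move=> /andP[].
    rewrite [RHS]lebesgue_measure_itv/= oppr0 addr0 lte_fin.
    by move: r0; rewrite lee_fin le_eqVlt => /predU1P[<-|->//]; rewrite ltxx.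
  have -> : xsection S x = `]0%R, +oo[%classic.
    apply/seteqP; split => t; rewrite /xsection /= inE /S /= E ltry in_itv/= andbT//.
    by move=> [].
  by rewrite [RHS]lebesgue_measure_itv/= ltry.
rewrite (fubini_tonelli (fun p : X * RR => (\1_S p)%:E))//=; last first.
  exact/measurable_EFinP.
apply: eq_integral => t _.
have -> : (fun x => (\1_S (x, t) : R)%:E) = (fun x => (\1_(ysection S t) x)%:E).
  by apply/funext => x; rewrite !indicE mem_ysection.
rewrite integral_indic//; last exact: measurable_ysection.
rewrite setIT /level_measure; congr (m _).
by apply/seteqP; split => x /=; rewrite /ysection /= inE.
Qed.

(** Joint measurability in the parameter and the level; applied twice, it makes [rearrangement]
    measurable. *)
Lemma measurable_level_measure d (X : measurableType d) d' (Y : measurableType d')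
    (m : {sigma_finite_measure set Y -> \bar R}) (g : X * Y -> \bar R) :
  measurable_fun [set: X * Y] g ->
  measurable_fun [set: X * RR] (fun p => level_measure m (fun y => g (p.1, y)) p.2).
Proof.
move=> mg; set S := [set p : (X * RR) * Y | (0 < p.1.2)%R /\ p.1.2%:E < g (p.1.1, p.2)].
have mS : measurable S.
  have := measurable_subgraph mg.
  set f := fun p : (X * RR) * Y => ((p.1.1, p.2), p.1.2).
  have mf : measurable_fun setT f.
    apply: measurable_fun_pair; [apply: measurable_fun_pair|].
    - exact: (measurableT_comp measurable_fst measurable_fst).
    - exact: measurable_snd.
    - exact: (measurableT_comp measurable_snd measurable_fst).
  by move=> /(mf measurableT); rewrite setTI.
have := measurable_fun_xsection m mS; apply: eq_measurable_fun => p _ /=.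
by rewrite /level_measure; congr (m _); apply/seteqP; split => y /=;
  rewrite /xsection /= inE.
Qed.

End level_measure.

(** * Affine changes of variable on the line *)

Section affine1.
Local Open Scope ereal_scope.
Context {R : realType}.
Notation RR := (measurableTypeR R).
Notation lam := (@lebesgue_measure R).

Lemma measurable_affine1 (a b : R) :
  measurable_fun [set: RR] (fun x : RR => (a * x + b)%R : RR).
Proof.
apply: measurable_funD => //; exact: measurable_funM.
Qed.

(** The pushforward of Lebesgue measure by the affine map, scaled by [a], agrees with Lebesgue
    measure on half-open intervals, which determine it. *)
Lemma lebesgue_measure_affine_gt0 (a b : R) (A : set RR) : (0 < a)%R -> measurable A ->
  a%:E * lam ((fun x => a * x + b)%R @^-1` A) = lam A.
Proof.
move=> a0 mA; pose r := NngNum (ltW a0).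
pose m : {measure set RR -> \bar R} :=
  @measure_function_pushforward__canonical__measure_function_Measure
    _ _ _ _ _ lam _ (measurable_affine1 a b).
apply/esym; rewrite -[RHS]/(mscale r m A); apply: lebesgue_measure_unique => //.
move=> _ [[c d] _ <-] /=.
rewrite /mscale /= /pushforward.
rewrite (_ : _ @^-1` _ = `](c - b) / a, (d - b) / a]%classic)%R; last first.
  by apply/seteqP; split => x /=; rewrite !in_itv/= ltr_pdivrMr// ler_pdivlMr//
    ltrBlDr lerBrDr (mulrC x).
rewrite [LHS]lebesgue_measure_itv [in RHS]lebesgue_measure_itv /= !lte_fin.
rewrite ltr_pM2r ?invr_gt0// ltrD2r; case: ifP => _; last by rewrite mule0.
by rewrite -!EFinD -EFinM; congr (_%:E); field; rewrite gt_eqF.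
Qed.

Lemma lebesgue_measure_affine (a b : R) (A : set RR) : (a != 0)%R -> measurable A ->
  `|a|%:E * lam ((fun x => a * x + b)%R @^-1` A) = lam A.
Proof.
move=> a0 mA; have [agt|alt] := ltP 0%R a.
  by rewrite gtr0_norm// lebesgue_measure_affine_gt0.
have {alt a0}a0 : (a < 0)%R by rewrite lt_neqAle a0.
have mN : measurable_fun [set: RR] (fun x : RR => (- x)%R : RR).
  have := measurable_affine1 (-1) 0; apply: eq_measurable_fun => x _.
  by rewrite mulN1r addr0.
rewrite ltr0_norm// -[RHS](lebesgue_measureN mA) /pushforward.
rewrite -[RHS](@lebesgue_measure_affine_gt0 (- a)%R (- b)%R); first last.
- by rewrite -[X in measurable X]setTI; exact: mN.
- by rewrite oppr_gt0.
congr (_ * lam _); apply/seteqP; split => x /=;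
  by rewrite (_ : - (- a * x - b) = a * x + b)%R//; ring.
Qed.

Lemma ge0_integral_affine (a b : R) (g : RR -> \bar R) : (a != 0)%R ->
  measurable_fun [set: RR] g -> (forall x, 0 <= g x) ->
  `|a|%:E * \int[lam]_x g (a * x + b)%R = \int[lam]_x g x.
Proof.
move=> a0 mg g0.
pose phi : RR -> RR := fun x => (a * x + b)%R.
have mphi : measurable_fun setT phi by exact: measurable_affine1.
rewrite -[X in _ * X]/(\int[lam]_(x in phi @^-1` setT) (g \o phi) x).
rewrite -ge0_integral_pushforward//.
pose r := NngNum (normr_ge0 a).
pose m : {measure set RR -> \bar R} :=
  @measure_function_pushforward__canonical__measure_function_Measure
    _ _ _ _ _ lam _ (measurable_affine1 a b).
rewrite -[`|a|%R]/(r%:num)%R.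
rewrite -(ge0_integral_mscale m measurableT r)//.
by apply: eq_measure_integral => A mA _; exact: lebesgue_measure_affine.
Qed.

End affine1.

(** * One-dimensional Brunn-Minkowski and Prekopa-Leindler inequalities *)

Section brunn_minkowski1.
Local Open Scope ereal_scope.
Context {R : realType}.
Notation RR := (measurableTypeR R).
Notation lam := (@lebesgue_measure R).

Lemma lebesgue_measure_translate (b : R) (A : set RR) : measurable A ->
  lam ((fun x => x + b)%R @^-1` A) = lam A.
Proof.
move=> mA; rewrite -[RHS](@lebesgue_measure_affine_gt0 R 1 b)// mul1e.
by congr (lam _); apply/seteqP; split => x /=; rewrite mul1r.
Qed.

(* The translates of [A] by [min B] and of [B] by [max A] meet in one point. *)
Lemma compact_brunn_minkowski1 (A B W : set RR) :
  A !=set0 -> B !=set0 -> compact (A : set R) -> compact (B : set R) -> measurable W ->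
  (forall x y, A x -> B y -> W (x + y)%R) -> lam A + lam B <= lam W.
Proof.
move=> A0 B0 cA cB mW ABW.
have mc (C : set R) : compact C -> measurable (C : set RR).
  by move=> cC; apply: closed_measurable; apply: compact_closed => //; exact: Rhausdorff.
have cid (C : set R) : {within C, continuous (fun x : R => x)}.
  by apply: continuous_subspaceT => x; exact: cvg_id.
have cN (C : set R) : {within C, continuous (fun x : R => - x)%R}.
  by apply: continuous_subspaceT => x; apply: cvgN; exact: cvg_id.
have [a aA maxa] := compact_EVT_max A0 cA (cid A).
have [b bB minb] := compact_EVT_max B0 cB (cN B).
rewrite inE in aA; rewrite inE in bB.
have mB1 : measurable (B `\ b : set RR) by apply: measurableD => //; exact: mc.
have mtr (c : R) (C : set RR) : measurable C ->
    measurable ((fun x => x + c)%R @^-1` C : set RR).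
  move=> mC; have := measurable_affine1 1 c measurableT mC; rewrite setTI.
  by rewrite (_ : (fun x => x + c) = (fun x => 1 * x + c))%R//; apply/funext => x; rewrite mul1r.
rewrite -(@lebesgue_measure_translate (- b)%R A); last exact: mc.
(* Dropping the point [b] makes the two translates disjoint at no cost in measure. *)
have -> : lam B = lam (B `\ b).
  rewrite -[in LHS](@setD1K _ b B)// measureU//.
    by rewrite [X in X + _]lebesgue_measure_set1 add0e.
  by apply/seteqP; split => x //= [-> [_]].
rewrite -(@lebesgue_measure_translate (- a)%R (B `\ b))//.
rewrite -measureU; [|by apply: mtr; exact: mc|exact: mtr|].
- apply: le_measure; rewrite ?inE//.
    by apply: measurableU; [apply: mtr; exact: mc|exact: mtr].
  move=> x [|[]] /=.
    by move=> Ax; have := ABW _ _ Ax bB; rewrite subrK.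
  by move=> Bx _; have := ABW _ _ aA Bx; rewrite addrC subrK.
- apply/seteqP; split => // x /= [Ax [Bx xab]].
  have := maxa (x - b)%R; rewrite inE => /(_ Ax) h1.
  have := minb (x - a)%R; rewrite inE => /(_ Bx) h2.
  by apply: xab; lra.
Qed.

(** Inner regularity reduces both summands to compact subsets, one after the other. *)
Lemma brunn_minkowski1 (A B W : set RR) :
  A !=set0 -> B !=set0 -> measurable A -> measurable B -> measurable W ->
  (forall x y, A x -> B y -> W (x + y)%R) -> lam A + lam B <= lam W.
Proof.
move=> [a Aa] [b Bb] mA mB mW ABW.
have mc (C : set R) : compact C -> measurable (C : set RR).
  by move=> cC; apply: closed_measurable; apply: compact_closed => //; exact: Rhausdorff.
have main (K L : set R) : compact K -> compact L -> K `<=` A -> L `<=` B ->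
    lam K + lam L <= lam W.
  move=> cK cL KA LB.
  (* The points [a] and [b] are adjoined because the approximating compact sets may be empty. *)
  have cK' : compact (K `|` [set a]) by apply: compactU => //; exact: compact_set1.
  have cL' : compact (L `|` [set b]) by apply: compactU => //; exact: compact_set1.
  apply: (@le_trans _ _ (lam (K `|` [set a]) + lam (L `|` [set b]))).
    by apply: leeD; apply: le_measure => //; rewrite ?inE; exact: mc.
  apply: compact_brunn_minkowski1 => //; [by exists a; right|by exists b; right|].
  by move=> x y [Kx|->] [Lx|->]; apply: ABW => //; [exact: KA|exact: LB|exact: KA|exact: LB].
rewrite (lebesgue_regularity_inner_sup mA).
have step (L : set R) : compact L -> L `<=` B -> lam A + lam L <= lam W.
  move=> cL LB; have fL : lam L \is a fin_num by rewrite ge0_fin_numE// compact_finite_measure.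
  rewrite -leeBrDr// (lebesgue_regularity_inner_sup mA).
  apply: ge_ereal_sup => _ [K [cK KA] <-]; rewrite leeBrDr//; exact: main.
rewrite -(lebesgue_regularity_inner_sup mA).
(* Moving [lam A] across the inequality needs it finite; otherwise the empty compact set already
   forces [lam W] to be infinite. *)
have [Afin|] := boolP (lam A \is a fin_num); last first.
  rewrite ge0_fin_numE// -leNgt leye_eq => /eqP Aoo.
  have := step set0 (@compact0 _) (@sub0set _ _).
  by rewrite Aoo measure0 adde0 leye_eq => /eqP ->; rewrite leey.
rewrite -leeBrDl// (lebesgue_regularity_inner_sup mB).
by apply: ge_ereal_sup => _ [L [cL LB] <-]; rewrite leeBrDl//; exact: step.
Qed.

Lemma brunn_minkowski1_conv (l : R) (A B W : set RR) : (0 < l < 1)%R ->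
  A !=set0 -> B !=set0 -> measurable A -> measurable B -> measurable W ->
  (forall x y, A x -> B y -> W ((1 - l) * x + l * y)%R) ->
  (1 - l)%:E * lam A + l%:E * lam B <= lam W.
Proof.
move=> /andP[l0 l1] [a Aa] [b Bb] mA mB mW ABW.
have k0 : (0 < 1 - l)%R by rewrite subr_gt0.
have msc (c : R) (C : set RR) : measurable C ->
    measurable ((fun x => c * x + 0)%R @^-1` C : set RR).
  by move=> mC; have := measurable_affine1 c 0 measurableT mC; rewrite setTI.
have sc (c : R) (C : set RR) : (0 < c)%R -> measurable C ->
    c%:E * lam C = lam ((fun x => c^-1 * x + 0)%R @^-1` C).
  move=> c0 mC; rewrite -(@lebesgue_measure_affine_gt0 R c^-1 0)// ?invr_gt0//.
  by rewrite muleA -EFinM divff ?gt_eqF// mul1e.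
rewrite !sc//; apply: brunn_minkowski1 => //; [| |exact: msc|exact: msc|].
- by exists ((1 - l) * a)%R => /=; rewrite addr0 mulKf ?gt_eqF.
- by exists (l * b)%R => /=; rewrite addr0 mulKf ?gt_eqF.
- move=> x y /= Ax By; have := ABW _ _ Ax By.
  by rewrite !addr0 !mulVKf ?gt_eqF.
Qed.

(** Concavity of the logarithm. *)
Lemma weighted_amgm (l a b : R) : (0 < l < 1)%R -> (0 < a)%R -> (0 < b)%R ->
  (a `^ (1 - l) * b `^ l <= (1 - l) * a + l * b)%R.
Proof.
move=> /andP[l0 l1] a0 b0.
have := @concave_ln R (Itv01 (ltW l0) (ltW l1)) b a b0 a0.
rewrite !convRE /= => H.
rewrite /powR !gt_eqF// -expRD -[leRHS]lnK ?posrE; last first.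
  by apply: addr_gt0; apply: mulr_gt0 => //; rewrite subr_gt0.
rewrite ler_expR addrC (le_trans H)//.
by rewrite addrC.
Qed.

End brunn_minkowski1.

Import HBNNSimple.

Section integral_sup.
Local Open Scope ereal_scope.
Context {R : realType} d (X : measurableType d) (m : {measure set X -> \bar R}).

Lemma lt_integral_nnsfun (g : X -> \bar R) (c : \bar R) : (forall x, 0 <= g x) ->
  c < \int[m]_x g x ->
  exists2 h : {nnsfun X >-> R}, (forall x, (h x)%:E <= g x) & c < \int[m]_x (h x)%:E.
Proof.
move=> g0; rewrite ge0_integralTE// => /ereal_sup_gt[_ [h hg <-] ch].
by exists h; rewrite ?integralT_nnsfun.
Qed.

(** The range is finite. An attained maximum keeps every strictly lower level set nonempty, as
    Brunn-Minkowski requires. *)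
Lemma nnsfun_max (h : {nnsfun X >-> R}) : [set: X] !=set0 ->
  exists x0, forall x, (h x <= h x0)%R.
Proof.
move=> [y0 _].
have /finite_seqP[s hs] : finite_set (range h) by [].
have hin x : h x \in s by have : range h (h x) by [exists x]; rewrite hs.
have : exists2 M, M \in s & forall y, y \in s -> (y <= M)%R.
  case: s {hs} hin => [/(_ y0)//|a s _].
  elim: s a => [a|b s IH a]; first by exists a; rewrite ?inE// => y /[!inE]/eqP ->.
  have [M Ms HM] := IH b; have [aM|Ma] := leP a M.
    exists M; first by rewrite inE Ms orbT.
    by move=> y /[!inE]/predU1P[->//|ys]; apply: HM; rewrite inE.
  exists a; first by rewrite inE eqxx.
  move=> y /[!inE]/predU1P[->//|ys]; apply: (le_trans _ (ltW Ma)).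
  by apply: HM; rewrite inE.
move=> [M Ms HM]; have : [set` s] M by [].
by rewrite -hs => -[x0 _ hx0]; exists x0 => x; rewrite hx0; exact: HM.
Qed.
End integral_sup.

Section prekopa_leindler1.
Local Open Scope ereal_scope.
Context {R : realType}.
Notation RR := (measurableTypeR R).
Notation lam := (@lebesgue_measure R).

Lemma lte_dense_real (s : R) (y : \bar R) : s%:E < y -> exists2 s', (s < s')%R & s'%:E < y.
Proof.
case: y => [r| |//]; last by move=> _; exists (s + 1)%R; rewrite ?ltrDl// ltry.
rewrite lte_fin => sr; exists ((s + r) / 2)%R; [lra|rewrite lte_fin; lra].
Qed.

Lemma gt0_ltr_powR_mul (l s s' t : R) : (0 < l < 1)%R -> (0 < s)%R -> (0 < t)%R ->
  (s < s')%R -> (s `^ (1 - l) * t `^ l < s' `^ (1 - l) * t `^ l)%R.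
Proof.
move=> /andP[l0 l1] s0 t0 ss'; rewrite ltr_pM2r ?powR_gt0//.
by apply: gt0_ltr_powR; rewrite ?subr_gt0// nnegrE ltW// (lt_trans s0).
Qed.

(* The pointwise bound [p x ^ (1 - l) * q y ^ l <= h z], phrased with real
   lower bounds of [p x] and [q y] since these may be infinite. *)
Definition geometric_bound (l : R) (p q h : \bar R) :=
  forall s t : R, (0 < s)%R -> (0 < t)%R -> s%:E < p -> t%:E < q ->
    (s `^ (1 - l) * t `^ l)%:E <= h.

(** Strictness is gained by raising [s] slightly while staying below [p]; level sets are defined by
    strict inequalities. *)
Lemma geometric_bound_lt (l : R) (p q h : \bar R) (s t : R) :
  (0 < l < 1)%R -> geometric_bound l p q h ->
  (0 < s)%R -> (0 < t)%R -> s%:E < p -> t%:E < q ->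
  (s `^ (1 - l) * t `^ l)%:E < h.
Proof.
move=> l01 H s0 t0 sp tq; have [s' ss' s'p] := lte_dense_real sp.
apply: lt_le_trans (H s' t (lt_trans s0 ss') t0 s'p tq).
by rewrite lte_fin gt0_ltr_powR_mul.
Qed.

Lemma powR_mul_weights (l a b u : R) : (0 <= a)%R -> (0 <= b)%R -> (0 < u)%R ->
  ((a * u) `^ (1 - l) * (b * u) `^ l = a `^ (1 - l) * b `^ l * u)%R.
Proof.
move=> a0 b0 u0; rewrite !powRM ?(ltW u0)// mulrACA; congr (_ * _)%R.
by rewrite -powRD ?(gt_eqF u0) ?implybT// subrK powRr1// ltW.
Qed.

(** Simple minorants [f] and [g] are normalised by their maxima [a] and [b]: for [0 < u < 1] the
    level sets at [a * u] and [b * u] are then both nonempty, and Brunn-Minkowski compares them with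
    the level set of [h] at [k * u]. At unnormalised levels one of the two sets could be empty while
    the other is not. *)
Lemma prekopa_leindler1 (l : R) (p q h : RR -> \bar R) : (0 < l < 1)%R ->
  measurable_fun [set: RR] h ->
  (forall x, 0 <= p x) -> (forall x, 0 <= q x) -> (forall x, 0 <= h x) ->
  (forall x y, geometric_bound l (p x) (q y) (h ((1 - l) * x + l * y)%R)) ->
  geometric_bound l (\int[lam]_x p x) (\int[lam]_x q x) (\int[lam]_x h x).
Proof.
move=> l01 mh p0 q0 h0 pqh s t s0 t0 /(lt_integral_nnsfun p0)[f fp sf]
  /(lt_integral_nnsfun q0)[g gq tg].
have /andP[l0 l1] := l01.
have [x0 fx0] := nnsfun_max f (ex_intro _ 0%R I).
have [y0 gy0] := nnsfun_max g (ex_intro _ 0%R I).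
set a := f x0; set b := g y0.
have pos (F : {nnsfun RR >-> R}) z0 (c : R) : (0 < c)%R ->
    c%:E < \int[lam]_x (F x)%:E -> (forall x, F x <= F z0)%R -> (0 < F z0)%R.
  move=> c0 cF Fz0; rewrite lt_neqAle fun_ge0 andbT; apply/eqP => F0.
  move: cF; rewrite integral0_eq ?lte_fin ?ltNge ?(ltW c0)// => x _.
  by congr (_%:E); apply/eqP; rewrite eq_le fun_ge0 andbT F0 Fz0.
have a0 : (0 < a)%R by exact: pos s0 sf fx0.
have b0 : (0 < b)%R by exact: pos t0 tg gy0.
pose k := (a `^ (1 - l) * b `^ l)%R.
have k0 : (0 < k)%R by rewrite mulr_gt0// powR_gt0.
have mlev (F : RR -> \bar R) : measurable_fun [set: RR] F ->
    measurable_fun [set: RR] (level_measure lam F).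
  move=> mF; have := @measurable_level_measure R _ RR _ RR lam (F \o snd).
  move=> /(_ (measurableT_comp mF measurable_snd)) H.
  have : measurable_fun [set: RR] (fun t : RR => (0%R : RR, t)) by exact: measurable_pair1.
  exact: measurableT_comp H.
have lev0 (F : RR -> \bar R) x : 0 <= level_measure lam F x by exact: measure_ge0.
have scale (F : RR -> \bar R) c : measurable_fun [set: RR] F -> (forall x, 0 <= F x) ->
    (0 < c)%R ->
    \int[lam]_x F x = c%:E * \int[lam]_u level_measure lam F (c * u + 0)%R.
  move=> mF F0 c0; rewrite (integral_level_measure lam)//.
  by rewrite -(@ge0_integral_affine _ c 0)// ?gt_eqF// ?gtr0_norm//; exact: mlev.
have mf : measurable_fun [set: RR] (EFin \o f) by exact/measurable_EFinP.
have mg : measurable_fun [set: RR] (EFin \o g) by exact/measurable_EFinP.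
have mlevc (F : RR -> \bar R) c : measurable_fun [set: RR] F ->
    measurable_fun [set: RR] (fun u => level_measure lam F (c * u + 0)%R).
  by move=> mF; apply: (measurableT_comp (mlev _ mF)); exact: measurable_affine1.
rewrite (@scale h k)//.
have fE : forall x, 0 <= (f x)%:E by move=> x; rewrite lee_fin.
have gE : forall x, 0 <= (g x)%:E by move=> x; rewrite lee_fin.
move: sf tg; rewrite (@scale _ a mf fE)// (@scale _ b mg gE)//.
set If := \int[lam]_u _; set Ig := \int[lam]_u _; set Ih := \int[lam]_u _.
move=> sf tg.
have IfgE : (1 - l)%:E * If + l%:E * Ig <= Ih.
  rewrite /If /Ig /Ih -!ge0_integralZl_EFin//; last 4 first.
  - exact: mlevc.
  - exact: ltW.
  - exact: mlevc.
  - by rewrite subr_ge0 ltW.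
  rewrite -ge0_integralD//; last 4 first.
  - by move=> x _; rewrite mule_ge0// lee_fin subr_ge0 ltW.
  - by apply: measurable_funeM; exact: mlevc.
  - by move=> x _; rewrite mule_ge0// lee_fin ltW.
  - by apply: measurable_funeM; exact: mlevc.
  apply: ge0_le_integral => //.
  - by move=> x _; rewrite adde_ge0// mule_ge0// lee_fin ?subr_ge0 ltW.
  - by apply: emeasurable_funD; apply: measurable_funeM; exact: mlevc.
  - exact: mlevc.
  - move=> u _; rewrite !addr0.
    have [/andP[u0 u1]|] := boolP (0 < u < 1)%R; last first.
      have lz (F : {nnsfun RR >-> R}) c z0 : (0 < c)%R -> c = F z0 -> (forall x, F x <= F z0)%R ->
          ~~ (0 < u < 1)%R -> level_measure lam (EFin \o F) (c * u)%R = 0.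
        move=> c0 cE Fz0 u01; rewrite /level_measure (_ : [set _ | _] = set0) ?measure0//.
        apply/seteqP; split => x //= [cu0]; rewrite lte_fin => cuF; apply/negP: u01.
        move: cu0; rewrite pmulr_rgt0// => u0; rewrite u0/=.
        by rewrite -(ltr_pM2l c0) mulr1 {2}cE (lt_le_trans cuF).
      move=> u01; rewrite (lz _ _ _ a0 erefl fx0 u01) (lz _ _ _ b0 erefl gy0 u01).
      by rewrite !mule0 adde0.
    apply: brunn_minkowski1_conv => //; try exact: measurable_level_set.
    + by exists x0; split; rewrite ?mulr_gt0// lte_fin gtr_pMr.
    + by exists y0; split; rewrite ?mulr_gt0// lte_fin gtr_pMr.
    + move=> x y [au0 auf] [bu0 bug]; split; first exact: mulr_gt0.
      have := geometric_bound_lt l01 (pqh x y) au0 bu0 (lt_le_trans auf (fp _))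
        (lt_le_trans bug (gq _)).
      by rewrite powR_mul_weights ?(ltW a0) ?(ltW b0)// -/k addr0.
have sf' : (s / a)%:E <= If.
  by rewrite ltW// mulrC EFinM lte_pdivrMl.
have tg' : (t / b)%:E <= Ig.
  by rewrite ltW// mulrC EFinM lte_pdivrMl.
(* The integrated inequality is additive; weighted AM-GM for [s / a] and [t / b] makes it
   multiplicative, and the factor [k] undoes the normalisation. *)
apply: (@le_trans _ _ (k%:E * ((1 - l)%:E * (s / a)%:E + l%:E * (t / b)%:E))); last first.
  apply: lee_wpmul2l; first by rewrite lee_fin ltW.
  apply: le_trans IfgE; apply: leeD; apply: lee_wpmul2l => //;
    by rewrite lee_fin ?subr_ge0 ltW.
rewrite -!EFinM lee_fin.
apply: le_trans (ler_wpM2l (ltW k0) (weighted_amgm l01 (divr_gt0 s0 a0) (divr_gt0 t0 b0))).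
have mulK (c z : R) : (0 < c)%R -> (c * (z / c) = z)%R.
  by move=> c0; rewrite mulrCA divff ?mulr1// gt_eqF.
by rewrite /k mulrACA -!powRM ?mulK// ltW// divr_gt0.
Qed.

End prekopa_leindler1.

(** * Lebesgue measure on R^n: Prekopa-Leindler and changes of variables *)

Section tuples.
Local Open Scope ereal_scope.
Context {R : realType}.
Notation RR := (measurableTypeR R).
Notation lam := (@lebesgue_measure R).
Notation T n := (n.-tuple (measurableTypeR R)).
Notation mu n := (@borel_lebesgue R n).

Lemma ge0_integral_borel_lebesgueS n (g : T n.+1 -> \bar R) :
  measurable_fun [set: T n.+1] g -> (forall x, 0 <= g x) ->
  \int[mu n.+1]_t g t = \int[lam]_x \int[mu n]_s g (tuple_cons (x, s)).
Proof.
move=> mg g0.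
rewrite -[LHS]/(\int[pushforward (lam \x mu n) (@tuple_cons R n)]_t g t).
rewrite ge0_integral_pushforward//; last exact: measurable_tuple_cons.
rewrite preimage_setT fubini_tonelli1//; last by move=> x; exact: g0.
by apply: measurableT_comp => //; exact: measurable_tuple_cons.
Qed.

Lemma ge0_integral_borel_lebesgue0 (g : T 0 -> \bar R) :
  measurable_fun [set: T 0] g -> (forall x, 0 <= g x) ->
  \int[mu 0]_t g t = g [tuple].
Proof.
by move=> mg g0; rewrite [LHS]integral_dirac// diracT mul1e.
Qed.

Definition tuple_conv n (l : R) (x y : T n) : T n :=
  [tuple ((1 - l) * tnth x i + l * tnth y i)%R | i < n].

Lemma tuple_conv_cons n l a b (x y : T n) :
  tuple_conv l (tuple_cons (a, x)) (tuple_cons (b, y)) =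
  tuple_cons (((1 - l) * a + l * b)%R, tuple_conv l x y).
Proof.
apply: eq_from_tnth => i; rewrite tnth_mktuple.
case: (unliftP ord0 i) => [j|] ->; last by rewrite !tnth0.
by rewrite !tnthS tnth_mktuple.
Qed.

Lemma measurable_tuple_cons2 d (X : measurableType d) n (f : X -> RR) (g : X -> T n) :
  measurable_fun [set: X] f -> measurable_fun [set: X] g ->
  measurable_fun [set: X] (fun x => tuple_cons (f x, g x)).
Proof.
move=> mf mg; apply: (measurableT_comp (@measurable_tuple_cons R n)).
exact: measurable_fun_pair.
Qed.

(** Induction on the dimension: for fixed first coordinates the inductive hypothesis gives a
    [geometric_bound] between section integrals, which is exactly the input of the one-dimensional
    case. *)
Lemma prekopa_leindler n (l : R) (p q h : T n -> \bar R) : (0 < l < 1)%R ->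
  measurable_fun [set: T n] p -> measurable_fun [set: T n] q ->
  measurable_fun [set: T n] h ->
  (forall x, 0 <= p x) -> (forall x, 0 <= q x) -> (forall x, 0 <= h x) ->
  (forall x y, geometric_bound l (p x) (q y) (h (tuple_conv l x y))) ->
  geometric_bound l (\int[mu n]_x p x) (\int[mu n]_x q x) (\int[mu n]_x h x).
Proof.
move=> l01; elim: n p q h => [|n IH] p q h mp mq mh p0 q0 h0 pqh.
  rewrite !ge0_integral_borel_lebesgue0//.
  by have := pqh [tuple] [tuple]; rewrite [tuple_conv _ _ _]tuple0.
rewrite !ge0_integral_borel_lebesgueS//.
have mcons (f : T n.+1 -> \bar R) : measurable_fun [set: T n.+1] f ->
    measurable_fun [set: RR * T n] (f \o @tuple_cons R n).
  by move=> mf; apply: measurableT_comp => //; exact: measurable_tuple_cons.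
have msec (f : T n.+1 -> \bar R) x : measurable_fun [set: T n.+1] f ->
    measurable_fun [set: T n] (fun s => f (tuple_cons (x, s))).
  move=> /mcons mf; exact: (measurableT_comp mf (measurable_pair1 x)).
apply: prekopa_leindler1 => //; try (by move=> x; apply: integral_ge0).
- apply: (measurable_fun_fubini_tonelli_F (h \o @tuple_cons R n)).
    exact: mcons.
  by move=> x; exact: h0.
- move=> x y; apply: IH => //; try exact: msec.
  by move=> s t; rewrite -tuple_conv_cons; exact: pqh.
Qed.

End tuples.

(** * Affine maps and concatenation of coordinates *)

Section tuple_maps.
Local Open Scope ereal_scope.
Context {R : realType}.
Notation RR := (measurableTypeR R).
Notation lam := (@lebesgue_measure R).
Notation T n := (n.-tuple (measurableTypeR R)).
Notation mu n := (@borel_lebesgue R n).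

Definition tuple_affine n (a : R) (b x : T n) : T n :=
  [tuple (a * tnth x i + tnth b i)%R | i < n].

Lemma measurable_tuple_affine n a (b : T n) : measurable_fun [set: T n] (tuple_affine a b).
Proof.
apply/measurable_fun_tnthP => i.
have := measurableT_comp (measurable_affine1 a (tnth b i)) (@measurable_tnth _ RR n i).
by apply: eq_measurable_fun => x _ /=; rewrite tnth_mktuple.
Qed.

Lemma tuple_affine_cons n a b (c : T n) x s :
  tuple_affine a (tuple_cons (b, c)) (tuple_cons (x, s)) =
  tuple_cons ((a * x + b)%R, tuple_affine a c s).
Proof.
apply: eq_from_tnth => i; rewrite tnth_mktuple.
case: (unliftP ord0 i) => [j|] ->; last by rewrite !tnth0.
by rewrite !tnthS tnth_mktuple.
Qed.

Lemma tuple_consP n (b : T n.+1) : exists c, b = tuple_cons c.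
Proof.
exists (thead b, [tuple of behead b]).
by rewrite [LHS]tuple_eta; apply: val_inj.
Qed.

Lemma measurable_tuple_section n (g : T n.+1 -> \bar R) x :
  measurable_fun [set: T n.+1] g ->
  measurable_fun [set: T n] (fun s => g (tuple_cons (x, s))).
Proof.
move=> mg; apply: (measurableT_comp mg).
by apply: measurable_tuple_cons2 => //; exact: measurable_cst.
Qed.

Lemma measurable_integral_tuple_cons n (g : T n.+1 -> \bar R) :
  measurable_fun [set: T n.+1] g -> (forall x, 0 <= g x) ->
  measurable_fun [set: RR] (fun x => \int[mu n]_s g (tuple_cons (x, s))).
Proof.
move=> mg g0; apply: (measurable_fun_fubini_tonelli_F (g \o @tuple_cons R n)).
  by apply: (measurableT_comp mg); exact: measurable_tuple_cons.
by move=> x; exact: g0.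
Qed.

Lemma ge0_integral_tuple_affine n a (b : T n) (g : T n -> \bar R) : (a != 0)%R ->
  measurable_fun [set: T n] g -> (forall x, 0 <= g x) ->
  (`|a| ^+ n)%:E * \int[mu n]_x g (tuple_affine a b x) = \int[mu n]_x g x.
Proof.
move=> a0; elim: n b g => [|n IH] b g mg g0.
  rewrite !ge0_integral_borel_lebesgue0// ?expr0 ?mul1e; last first.
    exact: (measurableT_comp mg (measurable_tuple_affine _ _)).
  by congr g; rewrite [LHS]tuple0.
have [[b0 c] ->] := tuple_consP b.
have mga : measurable_fun setT (fun x => g (tuple_affine a (tuple_cons (b0, c)) x)).
  exact: (measurableT_comp mg (measurable_tuple_affine _ _)).
rewrite !ge0_integral_borel_lebesgueS//.
have mI := measurable_integral_tuple_cons mg g0.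
have I0 x : 0 <= \int[mu n]_s g (tuple_cons (x, s)) by exact: integral_ge0.
rewrite -[RHS](@ge0_integral_affine _ a b0 _ a0 mI I0).
rewrite exprS EFinM -muleA; congr (_ * _).
rewrite -ge0_integralZl_EFin//; [|by move=> x _; apply: integral_ge0|
  exact: (measurable_integral_tuple_cons mga)].
apply: eq_integral => x _.
rewrite -[RHS](IH c)//; last exact: measurable_tuple_section.
congr (_ * _); apply: eq_integral => s _.
by rewrite tuple_affine_cons.
Qed.

Lemma borel_lebesgue_tuple_affine n a (b : T n) (S : set (T n)) : (a != 0)%R ->
  measurable S -> (`|a| ^+ n)%:E * mu n (tuple_affine a b @^-1` S) = mu n S.
Proof.
move=> a0 mS; have mS' : measurable (tuple_affine a b @^-1` S).
  by rewrite -[X in measurable X]setTI; exact: measurable_tuple_affine.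
have E A : measurable A -> mu n A = \int[mu n]_x (\1_A x)%:E.
  by move=> mA; rewrite integral_indic// setIT.
rewrite (E _ mS) (E _ mS') -[RHS](@ge0_integral_tuple_affine _ a b)//.
by apply/measurable_EFinP; exact: measurable_indic.
Qed.

Definition tuple_cat p q (z : T p * T q) : T (p + q) := [tuple of z.1 ++ z.2].

Lemma measurable_tuple_cat p q : measurable_fun [set: _] (@tuple_cat p q).
Proof.
apply/measurable_fun_tnthP => i.
case: (splitP i) => [j ij|j ij].
  have := measurableT_comp (@measurable_tnth _ RR p j) (@measurable_fst _ _ (T p) (T q)).
  apply: eq_measurable_fun => z _ /=.
  have -> : i = lshift q j by exact: val_inj.
  by rewrite tnth_lshift.
have := measurableT_comp (@measurable_tnth _ RR q j) (@measurable_snd _ _ (T p) (T q)).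
apply: eq_measurable_fun => z _ /=.
have -> : i = rshift p j by exact: val_inj.
by rewrite tnth_rshift.
Qed.

Lemma ge0_integral_tuple_cat p q (g : T (p + q) -> \bar R) :
  measurable_fun [set: T (p + q)] g -> (forall x, 0 <= g x) ->
  \int[mu (p + q)]_z g z = \int[mu p]_x \int[mu q]_y g (tuple_cat (x, y)).
Proof.
have mcat p' (h : T (p' + q) -> \bar R) : measurable_fun setT h -> (forall x, 0 <= h x) ->
    measurable_fun setT (fun x => \int[mu q]_y h (tuple_cat (x, y))).
  move=> mh h0; apply: (measurable_fun_fubini_tonelli_F (h \o @tuple_cat p' q)).
    by apply: (measurableT_comp mh); exact: measurable_tuple_cat.
  by move=> x; exact: h0.
elim: p g => [|p IH] g mg g0.
  rewrite ge0_integral_borel_lebesgue0//; last 2 first.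
  - exact: mcat.
  - by move=> x; exact: integral_ge0.
  by apply: eq_integral => y _; congr g; apply: val_inj.
rewrite [LHS](@ge0_integral_borel_lebesgueS _ (p + q) g mg g0).
rewrite ge0_integral_borel_lebesgueS//; last 2 first.
- exact: mcat.
- by move=> x; exact: integral_ge0.
apply: eq_integral => x _.
rewrite (IH (fun s => g (tuple_cons (x, s))) (measurable_tuple_section x mg) (fun _ => g0 _)).
apply: eq_integral => s _; apply: eq_integral => y _.
by congr g; apply: val_inj.
Qed.

End tuple_maps.

(** * Linear changes of variables *)

Section linear_change.
Context {R : realType}.
Notation RR := (measurableTypeR R).
Notation lam := (@lebesgue_measure R).
Notation T n := (n.-tuple (measurableTypeR R)).
Notation mu n := (@borel_lebesgue R n).

Definition tuple_of_row n (v : 'rV[R]_n) : T n := [tuple v 0 i | i < n].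

Lemma tuple_of_rowK n : cancel (@tuple_of_row n) (@row_of_tuple R n).
Proof. by move=> v; apply/rowP => i; rewrite mxE tnth_mktuple. Qed.

Lemma row_of_tupleK n : cancel (@row_of_tuple R n) (@tuple_of_row n).
Proof. by move=> t; apply: eq_from_tnth => i; rewrite tnth_mktuple mxE. Qed.

Definition tuple_mulmx m n (M : 'M[R]_(m, n)) (x : T m) : T n :=
  tuple_of_row (row_of_tuple x *m M).

Lemma row_of_tuple_mulmx m n (M : 'M[R]_(m, n)) x :
  row_of_tuple (tuple_mulmx M x) = row_of_tuple x *m M.
Proof. exact: tuple_of_rowK. Qed.

Lemma tuple_mulmxM m n p (M : 'M[R]_(m, n)) (N : 'M[R]_(n, p)) x :
  tuple_mulmx (M *m N) x = tuple_mulmx N (tuple_mulmx M x).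
Proof. by rewrite /tuple_mulmx tuple_of_rowK mulmxA. Qed.

Lemma measurable_tuple_mulmx m n (M : 'M[R]_(m, n)) :
  measurable_fun [set: T m] (tuple_mulmx M).
Proof.
apply/measurable_fun_tnthP => i.
have : measurable_fun [set: T m] (fun x => \sum_(j < m) (M j i * tnth x j + 0))%R.
  apply: measurable_sum => j.
  exact: (measurableT_comp (measurable_affine1 _ _) (@measurable_tnth _ RR m j)).
apply: eq_measurable_fun => x _ /=; rewrite tnth_mktuple mxE.
by apply: eq_bigr => j _; rewrite mxE addr0 mulrC.
Qed.

Lemma row_of_tuple_cons n (x : R) (s : T n) :
  row_of_tuple (tuple_cons (x, s)) = row_mx x%:M (row_of_tuple s) :> 'rV[R]_(1 + n).
Proof.
apply/rowP => i; rewrite mxE; case: (splitP i) => j ij.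
  have -> : i = lshift n j by exact: val_inj.
  rewrite (row_mxEl _ _ 0 j) ord1 mxE eqxx mulr1n.
  by rewrite (_ : lshift n 0 = ord0) ?tnth0//; exact: val_inj.
have -> : i = rshift 1 j by exact: val_inj.
rewrite (row_mxEr _ _ 0 j) mxE.
by rewrite (_ : rshift 1 j = lift ord0 j) ?tnthS//; exact: val_inj.
Qed.

Lemma tuple_of_row_row_mx n (x : 'M[R]_1) (v : 'rV[R]_n) :
  tuple_of_row (row_mx x v : 'rV[R]_(1 + n)) = tuple_cons (x 0 0, tuple_of_row v).
Proof.
apply: (can_inj (@row_of_tupleK (1 + n))); rewrite tuple_of_rowK.
by rewrite row_of_tuple_cons tuple_of_rowK -mx11_scalar.
Qed.

Lemma tuple_mulmx_block n a (u : 'rV[R]_n) (w : 'cV[R]_n) (S : 'M[R]_n) x s :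
  tuple_mulmx (block_mx a%:M u w S : 'M[R]_(1 + n)) (tuple_cons (x, s)) =
  tuple_cons ((x * a + (row_of_tuple s *m w) 0 0)%R,
              tuple_of_row (x *: u + row_of_tuple s *m S)).
Proof.
rewrite /tuple_mulmx row_of_tuple_cons mul_row_block tuple_of_row_row_mx.
by rewrite -scalar_mxM mul_scalar_mx !mxE eqxx mulr1n.
Qed.

(** A predicate on the matrix, so that it can be multiplied along a factorisation into shears and
    diagonal blocks. *)
Definition change_of_variables n (M : 'M[R]_n) :=
  forall g : T n -> \bar R, measurable_fun [set: T n] g -> (forall x, 0 <= g x)%E ->
  (`|\det M|%:E * \int[mu n]_x g (tuple_mulmx M x) = \int[mu n]_x g x)%E.

Lemma change_of_variablesM n (M N : 'M[R]_n) :
  change_of_variables M -> change_of_variables N -> change_of_variables (M *m N).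
Proof.
move=> hM hN g mg g0; rewrite -(hN g)// -(hM (fun x => g (tuple_mulmx N x)))//; last first.
  exact: (measurableT_comp mg (measurable_tuple_mulmx _)).
rewrite muleA -EFinM -normrM det_mulmx mulrC; congr (_ * _)%E.
by apply: eq_integral => x _; rewrite tuple_mulmxM.
Qed.

Lemma tuple_of_row_shift n (b s : T n) :
  tuple_of_row (row_of_tuple b + row_of_tuple s) = tuple_affine 1 b s.
Proof.
by apply: eq_from_tnth => i; rewrite !tnth_mktuple !mxE mul1r addrC.
Qed.

Lemma change_of_variables_upper_shear n (u : 'rV[R]_n) :
  change_of_variables (block_mx 1%:M u 0 1%:M : 'M[R]_(1 + n)).
Proof.
move=> g mg g0; rewrite det_ublock !det1 mulr1 normr1 mul1e.
rewrite [LHS](@ge0_integral_borel_lebesgueS _ n)//; last first.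
  exact: (measurableT_comp mg (measurable_tuple_mulmx _)).
rewrite [RHS](@ge0_integral_borel_lebesgueS _ n _ mg g0).
apply: eq_integral => x _.
rewrite -[RHS](@ge0_integral_tuple_affine _ _ 1 (tuple_of_row (x *: u)))//; last first.
  exact: measurable_tuple_section.
rewrite normr1 expr1n mul1e; apply: eq_integral => s _.
by rewrite tuple_mulmx_block mulr1 mulmx0 mxE addr0 mulmx1 -tuple_of_row_shift tuple_of_rowK.
Qed.

(** Only the first coordinate moves, by an amount depending on the others, so it has to be
    integrated innermost; hence the exchange by Tonelli on both sides. *)
Lemma change_of_variables_lower_shear n (w : 'cV[R]_n) :
  change_of_variables (block_mx 1%:M 0 w 1%:M : 'M[R]_(1 + n)).
Proof.
move=> g mg g0; rewrite det_lblock !det1 mulr1 normr1 mul1e.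
have mgM := measurableT_comp mg (measurable_tuple_mulmx (block_mx 1%:M 0 w 1%:M : 'M[R]_(1 + n))).
have mcons (f : T n.+1 -> \bar R) : measurable_fun [set: T n.+1] f ->
    measurable_fun [set: RR * T n] (f \o @tuple_cons R n).
  by move=> mf; apply: measurableT_comp => //; exact: measurable_tuple_cons.
rewrite [LHS](@ge0_integral_borel_lebesgueS _ n)//.
rewrite [RHS](@ge0_integral_borel_lebesgueS _ n _ mg g0).
rewrite (fubini_tonelli (_ \o @tuple_cons R n) (mcons _ mgM))/=; last by move=> x; exact: g0.
rewrite (fubini_tonelli (_ \o @tuple_cons R n) (mcons _ mg))/=; last by move=> x; exact: g0.
apply: eq_integral => s _.
rewrite -[RHS](@ge0_integral_affine _ 1 ((row_of_tuple s *m w) 0 0))//; last first.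
  exact: (measurableT_comp (mcons _ mg) (measurable_pair2 s)).
rewrite normr1 mul1e; apply: eq_integral => x _ /=.
by rewrite tuple_mulmx_block mulr1 scaler0 add0r mulmx1 row_of_tupleK mul1r.
Qed.

Lemma change_of_variables_diag n a (S : 'M[R]_n) : (a != 0)%R ->
  change_of_variables S -> change_of_variables (block_mx a%:M 0 0 S : 'M[R]_(1 + n)).
Proof.
move=> a0 hS g mg g0; rewrite det_ublock det_scalar1 normrM EFinM.
have mgM := measurableT_comp mg (measurable_tuple_mulmx (block_mx a%:M 0 0 S : 'M[R]_(1 + n))).
rewrite [in LHS](@ge0_integral_borel_lebesgueS _ n)//.
rewrite [RHS](@ge0_integral_borel_lebesgueS _ n _ mg g0).
have mI := measurable_integral_tuple_cons mg g0.
have I0 x : (0 <= \int[mu n]_s g (tuple_cons (x, s)))%E by exact: integral_ge0.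
rewrite -[RHS](@ge0_integral_affine _ a 0 _ a0 mI I0).
rewrite -muleA -ge0_integralZl_EFin//; [|by move=> x _; apply: integral_ge0|
  exact: (@measurable_integral_tuple_cons _ n _ mgM (fun x => g0 _))].
congr (_ * _)%E; apply: eq_integral => x _.
rewrite -[RHS]hS//; last exact: measurable_tuple_section.
congr (_ * _)%E; apply: eq_integral => s _.
by rewrite tuple_mulmx_block mulmx0 mxE scaler0 add0r addr0 addr0 mulrC.
Qed.

(* Gaussian elimination without permutations: a vanishing pivot is first made
   nonzero by adding another row, which is again a shear. *)
Lemma ge0_integral_tuple_mulmx n (M : 'M[R]_n) : M \in unitmx -> change_of_variables M.
Proof.
elim: n M => [|n IH] M uM.
  move=> g mg g0; rewrite det_mx00 normr1 mul1e.
  rewrite !ge0_integral_borel_lebesgue0//; last first.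
    exact: (measurableT_comp mg (measurable_tuple_mulmx _)).
  by congr g; rewrite [LHS]tuple0.
have pivot (N : 'M[R]_(1 + n)) : N \in unitmx -> N 0 0 != 0%R -> change_of_variables N.
  rewrite -[N]submxK; move: (ulsubmx N) (ursubmx N) (dlsubmx N) (drsubmx N).
  move=> a u w S; rewrite [a]mx11_scalar; move: (a 0 0) => {}a.
  rewrite (_ : (block_mx a%:M u w S : 'M[R]_(1 + n)) 0 0 = a); last first.
    rewrite (_ : (0 : 'I_(1 + n)) = lshift n 0); last exact: val_inj.
    by rewrite block_mxEul mxE eqxx mulr1n.
  move=> uN a0.
  (* Lower-diagonal-upper factorisation, with the Schur complement of the pivot [a] in the diagonal
     factor. *)
  have E : block_mx a%:M u w S = block_mx 1%:M 0 (a^-1 *: w) 1%:M *m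
      (block_mx a%:M 0 0 (S - a^-1 *: (w *m u)) *m
       block_mx 1%:M (a^-1 *: u) 0 1%:M) :> 'M[R]_(1 + n).
    rewrite !mulmx_block !(mul0mx, mulmx0, mul1mx, mulmx1, addr0, add0r).
    rewrite mul_scalar_mx mul_mx_scalar !scalerA mulfV// !scale1r.
    by rewrite -scalemxAl addrC subrK.
  rewrite E; apply: change_of_variablesM; first exact: change_of_variables_lower_shear.
  apply: change_of_variablesM; last exact: change_of_variables_upper_shear.
  apply: change_of_variables_diag => //; apply: IH.
  move: uN; rewrite E unitmxE !det_mulmx det_lblock !det_ublock !det1 !mul1r !mulr1.
  by rewrite unitrM => /andP[_]; rewrite -unitmxE.
have [M00|] := eqVneq (M 0 0) 0%R; last exact: pivot.
have [i wi] : exists i : 'I_n, M (rshift 1 i) 0 != 0%R.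
  apply/existsP; apply: contraLR uM; rewrite negb_exists => /forallP h.
  have h0 i : M i 0 = 0%R.
    case: (splitP (i : 'I_(1 + n))) => j ij.
      by rewrite -M00; congr (M _ _); apply: val_inj; rewrite /= ij ord1.
    have -> : i = rshift 1 j by exact: val_inj.
    by apply/eqP; have := h j; rewrite negbK.
  rewrite unitmxE (expand_det_col _ 0) big1 ?unitr0// => k _.
  by rewrite h0 mul0r.
pose U (c : R) : 'M[R]_(1 + n) := block_mx 1%:M (c *: delta_mx 0 i) 0 1%:M.
have -> : M = U (-1) *m (U 1 *m M).
  rewrite mulmxA /U mulmx_block !(mul0mx, mulmx0, mul1mx, mulmx1, addr0, add0r).
  by rewrite scaleN1r scale1r subrr -scalar_mx_block mul1mx.
apply: change_of_variablesM; first exact: change_of_variables_upper_shear.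
apply: pivot.
  rewrite unitmxE det_mulmx det_ublock !det1 !mul1r -unitmxE//.
suff -> : (U 1 *m M) 0 0 = M (rshift 1 i) 0 by [].
have l0 : (0 : 'I_(1 + n)) = lshift n 0 by exact: val_inj.
rewrite mxE (@big_split_ord _ _ _ 1 n) big_ord1 -l0 M00 mulr0 /= add0r (bigD1 i)//=.
rewrite {1}l0 /U block_mxEur scale1r mxE !eqxx mul1r big1 ?addr0// => j ji.
by rewrite {1}l0 block_mxEur mxE (negbTE ji) mul0r.
Qed.

End linear_change.

Import HBNNSimple.

(** * Borel minorants and majorants for the completed measure *)

Section completion.
Local Open Scope ereal_scope.
Context {R : realType} d (X : measurableType d)
  (mu : {measure set X -> \bar R})
  (sfmu : sigma_finite [set: X] mu).
Notation outer := (mu^*)%mu.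
Notation cX := (caratheodory_type (mu^*)%mu).
Notation cmu := (@completed_measure_extension _ _ _ mu).

Lemma measurable_caratheodory (A : set X) : measurable A -> measurable (A : set cX).
Proof. by move=> mA; exact: caratheodory_measurable_mu_ext. Qed.

Lemma completed_measureE (A : set X) : measurable A -> cmu A = mu A.
Proof. by move=> mA; exact: measurable_mu_extE. Qed.

(** Intersect countably many Borel covers whose measures exceed [outer A] by at most
    [1 / (n + 1)]. *)
Lemma measurable_hull_finite (A : set X) : outer A < +oo ->
  exists B, [/\ measurable B, A `<=` B & mu B <= outer A].
Proof.
move=> Aoo.
have Afin : outer A \is a fin_num by rewrite ge0_fin_numE// outer_measure_ge0.
have cover (n : nat) : exists U, [/\ measurable U, A `<=` U & mu U <= outer A + n.+1%:R^-1%:E].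
  have e0 : (0 < n.+1%:R^-1 :> R)%R by rewrite invr_gt0.
  have [_ [F [mF AF] <-] FA] := lb_ereal_inf_adherent e0 Afin.
  exists (\bigcup_k F k); split => //; first exact: bigcupT_measurable.
  apply: le_trans (ltW FA); apply: measure_sigma_subadditive => //.
  exact: bigcupT_measurable.
have [U HU] := choice cover.
have mB : measurable (\bigcap_n U n) by apply: bigcapT_measurable => n; have [] := HU n.
exists (\bigcap_n U n); split => //.
  by move=> x Ax n _; have [_ + _] := HU n; exact.
apply/lee_addgt0Pr => e e0.
have [n ne] := ltr_add_invr e0.
have [mU _ Un] := HU n; apply: (@le_trans _ _ (mu (U n))).
  by apply: le_measure; rewrite ?inE//; exact: bigcap_inf.
by apply: (le_trans Un); rewrite leeD2l// lee_fin; rewrite add0r in ne; exact: ltW.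
Qed.

(** The set is cut along a sigma-finite cover, since the difference is shown to be null by
    cancelling a finite outer measure in Caratheodory's identity. *)
Lemma measurable_hull (A : set cX) : measurable A ->
  exists B : set X, [/\ measurable B, A `<=` B & outer (B `\` A) = 0].
Proof.
move=> mA.
have [S SU /all_and2[mS Soo]] := sfmu.
have hull k : exists B : set X, [/\ measurable B, A `&` S k `<=` B &
    outer (B `\` (A `&` S k)) = 0].
  have mAS : measurable (A `&` S k : set cX).
    by apply: measurableI => //; exact: measurable_caratheodory.
  have finAS : outer (A `&` S k) < +oo.
    apply: (@le_lt_trans _ _ (outer (S k))); first exact: le_outer_measure.
    by rewrite measurable_mu_extE.
  have [B [mB AB muB]] := measurable_hull_finite finAS.
  exists B; split => //; have := mAS B; rewrite (setIidr AB) => HB.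
  have fin : outer (A `&` S k) \is a fin_num by rewrite ge0_fin_numE// outer_measure_ge0.
  apply/eqP; rewrite eq_le outer_measure_ge0 andbT.
  rewrite -(leeD2lE _ _ fin) adde0 -[leLHS]HB.
  by apply: le_trans muB; rewrite -(measurable_mu_extE mu mB).
have [B HB] := choice hull.
exists (\bigcup_k B k); split.
- by apply: bigcupT_measurable => k; have [] := HB k.
- move=> x Ax; have [k _ Sx] : (\bigcup_k S k) x by rewrite -SU.
  by exists k => //; have [_ + _] := HB k; exact.
- apply/eqP; rewrite eq_le outer_measure_ge0 andbT.
  apply: (@le_trans _ _ (outer (\bigcup_k (B k `\` (A `&` S k))))).
    apply: le_outer_measure => x [[k _ Bx] nAx]; exists k => //; split=> // -[].
    by [].
  apply: (le_trans (outer_measure_sigma_subadditive _ _)).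
  by rewrite eseries0// => k _ _; have [] := HB k.
Qed.

(** The complement of a hull of the complement. *)
Lemma measurable_kernel (A : set cX) : measurable A ->
  exists B : set X, [/\ measurable B, B `<=` A & mu B = outer A].
Proof.
move=> mA; have [B [mB AB B0]] := measurable_hull (measurableC mA).
exists (~` B); split; first exact: measurableC.
  by move=> x Bx; apply: contrapT => /AB.
rewrite -(measurable_mu_extE mu (measurableC mB)).
apply/eqP; rewrite eq_le; apply/andP; split.
  by apply: le_outer_measure => x Bx; apply: contrapT => /AB.
have -> : outer A = outer (A `&` ~` B) + outer (A `&` ~` ~` B).
  exact: (measurable_caratheodory (measurableC mB) A).
have -> : outer (A `&` ~` ~` B) = 0.
  apply/eqP; rewrite eq_le outer_measure_ge0 andbT -B0; apply: le_outer_measure => x.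
  by rewrite setCK => -[Ax Bx]; split.
by rewrite adde0; apply: le_outer_measure => x [].
Qed.

(** Meant for [g] of unknown measurability, such as projections: the integral is a supremum over
    simple functions. Replacing each level set of a simple function by a Borel kernel of the same
    measure gives a Borel minorant with the same integral. *)
Lemma completed_integral_le (g : X -> \bar R) (K : \bar R) : (forall x, 0 <= g x) ->
  (forall s : X -> \bar R, measurable_fun [set: X] s -> (forall x, 0 <= s x) ->
     (forall x, s x <= g x) -> \int[mu]_x s x <= K) ->
  \int[cmu]_x g x <= K.
Proof.
move=> g0 H; rewrite ge0_integralTE//; apply: ge_ereal_sup => _ [h hg <-].
have /choice[B HB] (y : R) : exists B : set X, [/\ measurable B,
    B `<=` h @^-1` [set y] & mu B = outer (h @^-1` [set y])].
  by apply: measurable_kernel; exact: measurable_funPTI.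
pose s x := \sum_(y \in range h) (y * \1_(B y) x)%:E.
have B1 y x : B y x -> h x = y by have [_ + _] := HB y => /[apply].
have sE x : s x <= (h x)%:E.
  rewrite /s fsumEFin// lee_fin (fsbigD1 (h x))//=; last by exists x.
  rewrite fsbig1 ?addr0; last first.
    move=> y [_ hy]; rewrite indicE memNset ?mulr0// => /B1 hxy.
    by apply: hy.
  by rewrite indicE; case: (_ \in _); rewrite ?mulr1// mulr0.
have ms0 y x : 0 <= (y * \1_(B y) x)%:E.
  rewrite lee_fin indicE; case: (boolP (x \in B y)); rewrite ?mulr0// mulr1 inE.
  by move=> /B1 <-; exact: fun_ge0.
have mB y : measurable (B y) by have [] := HB y.
have my y : measurable_fun [set: X] (fun x => (y * \1_(B y) x)%:E).
  by apply/measurable_EFinP; apply: measurable_funM => //; exact: measurable_indic.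
have -> : sintegral cmu h = \int[mu]_x s x.
  rewrite sintegralE /s ge0_integral_fsum//.
  apply: eq_fsbigr => y /[!inE] yh; rewrite (@integralZl_indic _ _ _ _ _ _ B)//; last first.
    by move=> y0; apply/seteqP; split => // x /B1 hxy; move: y0; rewrite -hxy ltNge fun_ge0.
  by rewrite integral_indic// setIT; have [_ _ ->] := HB y.
apply: H.
- by apply: emeasurable_fsum.
- by move=> x; rewrite fsume_ge0.
- by move=> x; apply: le_trans (sE x) (hg x).
Qed.

Lemma measurable_fun_caratheodory (s : X -> \bar R) : measurable_fun [set: X] s ->
  measurable_fun [set: cX] s.
Proof.
by move=> ms _ Y mY; apply: measurable_caratheodory; exact: ms.
Qed.

(** As [g] may fail to be measurable, the comparison is made on simple functions: each Borel one
    below [s] is repackaged over the completed sigma-algebra with the same integral. *)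
Lemma le_completed_integral (s g : X -> \bar R) : measurable_fun [set: X] s ->
  (forall x, 0 <= s x) -> (forall x, s x <= g x) ->
  \int[mu]_x s x <= \int[cmu]_x g x.
Proof.
move=> ms s0 sg; rewrite !ge0_integralTE//; last by move=> x; exact: le_trans (s0 x) (sg x).
apply: ge_ereal_sup => _ [h hs <-]; apply: ereal_sup_ubound.
have mh : measurable_fun [set: cX] h.
  by move=> _ Y mY; apply: measurable_caratheodory; exact: (measurable_funP h).
pose mh' := isMeasurableFun.Build _ _ cX R (h : cX -> R) mh.
pose fh' := FiniteImage.Build cX R (h : cX -> R) (fimfunP h).
pose nh' := isNonNegFun.Build cX R (h : cX -> R) (@fun_ge0 _ _ h).
pose h' : {nnsfun cX >-> R} := HB.pack (h : cX -> R) mh' fh' nh'.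
exists h'; first by move=> x; exact: le_trans (hs x) (sg x).
rewrite !sintegralE; apply: eq_fsbigr => y _; congr (_ * _).
exact: (completed_measureE (measurable_funPTI h (measurable_set1 y))).
Qed.

(* The majorant is the supremum of [q] times the indicator of a Borel hull of
   [f > q], over the nonnegative rationals [q]. *)
Lemma measurable_majorant (f : X -> R) : (forall x, 0 <= f x)%R ->
  measurable_fun [set: cX] f ->
  exists g : X -> \bar R, [/\ measurable_fun [set: X] g, forall x, (f x)%:E <= g x &
    \int[mu]_x g x <= \int[cmu]_x (f x)%:E].
Proof.
move=> f0 mf.
(* Every nonnegative rational occurs in this enumeration; a [k] that encodes no rational yields
   0. *)
pose q (k : nat) : R := `|ratr (odflt 0 (unpickle k : option rat))|%R.
have q0 k : (0 <= q k)%R by exact: normr_ge0.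
pose A k : set cX := [set x | (q k < f x)%R].
have mA k : measurable (A k).
  have -> : A k = f @^-1` `]q k, +oo[%classic.
    by apply/seteqP; split => x; rewrite /A /= in_itv/= andbT.
  by rewrite -[X in measurable X]setTI; exact: mf.
have /choice[B HB] k : exists B : set X, [/\ measurable B, A k `<=` B &
   outer (B `\` A k) = 0] by exact: measurable_hull.
pose u k x := (q k * \1_(B k) x)%:E.
pose g x := esups (u ^~ x) 0%N.
have mu_ k : measurable_fun [set: X] (u k).
  apply/measurable_EFinP; apply: measurable_funM => //.
  by apply: measurable_indic; have [] := HB k.
have mg : measurable_fun [set: X] g.
  by apply: measurable_fun_esups => k; exact: mu_.
have u0 k x : 0 <= u k x by rewrite lee_fin mulr_ge0// indicE ler0n.
have ug k x : u k x <= g x by apply: ereal_sup_ubound; exists k.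
have g0 x : 0 <= g x by exact: le_trans (u0 0%N x) (ug _ _).
have fg x : (f x)%:E <= g x.
  rewrite leNgt; apply/negP => gf.
  have gE : g x = (fine (g x))%:E.
    by rewrite fineK// ge0_fin_numE// (lt_trans gf)// ltry.
  have gx0 := g0 x; rewrite gE lee_fin in gx0; rewrite gE lte_fin in gf.
  have [r] := rat_in_itvoo gf; rewrite in_itv/= => /andP[gr rf].
  have qr : q (pickle r) = ratr r by rewrite /q pickleK/= ger0_norm// (le_trans gx0)// ltW.
  have := ug (pickle r) x; rewrite gE /u qr indicE mem_set; last first.
    by have [_ + _] := HB (pickle r); apply; rewrite /A /= qr.
  by rewrite mulr1 lee_fin leNgt gr.
exists g; split => //.
rewrite (le_trans (le_completed_integral mg g0 (fun x => lexx _)))//.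
rewrite le_eqVlt; apply/orP; left; apply/eqP.
apply: (ge0_ae_eq_integral measurableT).
- exact: measurable_fun_caratheodory.
- exact/measurable_EFinP.
- by move=> x _; exact: g0.
- by move=> x _; rewrite lee_fin.
(* Where [g] exceeds [f], some [q k] lies above the value of [f] at a point of the hull [B k], which
   is then outside [A k]. *)
- exists (\bigcup_k (B k `\` A k)); split.
  + apply: bigcupT_measurable => k; apply: measurableD => //.
    by apply: measurable_caratheodory; have [] := HB k.
  + apply/eqP; rewrite eq_le measure_ge0 andbT.
    apply: (le_trans (outer_measure_sigma_subadditive _ _)).
    by rewrite eseries0// => k _ _; have [] := HB k.
  + move=> x /= /not_implyP[_ gf]; apply: contrapT => nN; apply: gf.
    apply/eqP; rewrite eq_le fg andbT; apply: ge_ereal_sup => _ [k _ <-].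
    rewrite /u indicE lee_fin; case: (boolP (x \in B k)); rewrite ?mulr0// inE mulr1 => Bx.
    rewrite leNgt; apply/negP => fq; apply: nN; exists k => //; split => //.
    by rewrite /A /= => /(lt_trans fq); rewrite ltxx.
Qed.

End completion.

(** * The inequality in coordinates *)

Section beta_integral.
Context {R : realType}.
Notation lam := (@lebesgue_measure R).

Lemma powR_exprK (c : nat) (x : R) : (0 < c)%N -> 0 <= x -> (x ^+ c) `^ c%:R^-1 = x.
Proof.
move=> c0 x0; rewrite -powR_mulrn// -powRrM divff ?powRr1//.
by rewrite pnatr_eq0 -lt0n.
Qed.

Lemma exprK_powR (c : nat) (x : R) : (0 < c)%N -> 0 <= x -> (x `^ c%:R^-1) ^+ c = x.
Proof.
move=> c0 x0; rewrite -powR_mulrn ?powR_ge0// -powRrM mulVf ?powRr1//.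
by rewrite pnatr_eq0 -lt0n.
Qed.

(** The root need not be differentiable at 0, so the left endpoint is treated separately, as a
    limit. *)
Lemma within_continuous_root (a c : nat) : (0 < c)%N ->
  {within `[0, 1]%classic, continuous (fun u : R => (1 - u `^ c%:R^-1) ^+ a)}.
Proof.
move=> c0; have cinv : 0 < c%:R^-1 :> R by rewrite invr_gt0 ltr0n.
have cX (y : R) : continuous_at y (fun u : R => (1 - u) ^+ a).
  by exact: continuous_onemXn.
have cp (u : R) : 0 < u -> {for u, continuous (fun u : R => u `^ c%:R^-1)}.
  move=> u0; apply/differentiable_continuous/derivable1_diffP.
  by apply: derivable_powR; rewrite in_itv/= u0.
apply/continuous_within_itvP => //; split.
- move=> u /[!in_itv]/= /andP[u0 u1].
  exact: (@continuous_comp _ _ _ _ (fun u : R => (1 - u) ^+ a) _ (cp _ u0) (cX _)).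
- rewrite powR0 ?gt_eqF//.
  apply: (@cvg_comp _ _ _ _ (fun u : R => (1 - u) ^+ a)); first exact: powR_cvg0.
  exact: cX.
- apply: cvg_at_left_filter.
  exact: (@continuous_comp _ _ _ _ (fun u : R => (1 - u) ^+ a) _ (cp _ ltr01) (cX _)).
Qed.

(** The substitution [u = x ^+ c] gives [c] times the integral of [x ^+ c.-1 * (1 - x) ^+ a], that
    is, c (c - 1)! a! / (a + c)!. *)
Lemma integral_root_beta (a c : nat) : (0 < c)%N ->
  (\int[lam]_(u in `]0%R, 1%R[) ((1 - u `^ c%:R^-1) ^+ a)%:E = ('C(a + c, a)%:R^-1)%:E)%E.
Proof.
move=> c0.
have mf : measurable_fun (`]0, 1[%classic : set (measurableTypeR R)) 
    (fun u : R => ((1 - u `^ c%:R^-1) ^+ a)%:E).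
  apply/measurable_EFinP.
  apply: (@measurable_funS _ _ _ _ (`[0, 1]%classic : set (measurableTypeR R))) => //.
    by move=> x /=; rewrite !in_itv/= => /andP[x0 x1]; rewrite !ltW.
  by apply: subspace_continuous_measurable_fun => //; exact: within_continuous_root.
rewrite -(@integral_itv_bndoo _ _ _ _ true false)//.
have dF (x : R) : derivable (fun x : R => x ^+ c) x 1 by exact: exprn_derivable.
have F'E : (fun x : R => x ^+ c)^`()%classic = (fun x => c%:R * x ^+ c.-1).
  by apply/funext => x; rewrite derive1E exp_derive scaler1.
have cF' : continuous (fun x : R => c%:R * x ^+ c.-1).
  by move=> x; apply: cvgM; [exact: cvg_cst|exact: exprn_continuous].
have := @integration_by_substitution_increasing R (fun x => x ^+ c)
  (fun u => (1 - u `^ c%:R^-1) ^+ a) 0 1 ler01.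
rewrite expr0n expr1n (gtn_eqF c0) mulr0n F'E => -> //; last 5 first.
- move=> x y /[!in_itv]/= /andP[x0 _] /andP[y0 _] xy.
  by rewrite ltr_pXn2r.
- apply/cvg_ex; exists (c%:R * 0 ^+ c.-1); apply: cvg_at_right_filter; exact: cF'.
- apply/cvg_ex; exists (c%:R * 1 ^+ c.-1); apply: cvg_at_left_filter; exact: cF'.
- split; first by move=> x _; exact: dF.
  + by apply: cvg_at_right_filter; exact: exprn_continuous.
  + by apply: cvg_at_left_filter; exact: exprn_continuous.
- exact: within_continuous_root.
transitivity (c%:R%:E * \int[lam]_x (((@XMonemX R c.-1 a) \_ `[0%R, 1%R]) x)%:E)%E.
  rewrite -ge0_integralZl_EFin//; last 2 first.
  - by move=> x _; rewrite lee_fin patchE; case: ifPn => //; rewrite inE => /XMonemX_ge0.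
  - apply/measurable_EFinP; apply/measurable_restrict => //.
    by rewrite setTI; exact: measurable_XMonemX.
  rewrite [LHS]integral_mkcond; apply: eq_integral => x _.
  rewrite !patchE; case: ifPn => [|_]; last by rewrite mule0.
  rewrite inE /= in_itv/= => /andP[x0 x1].
  rewrite -EFinM; congr (_%:E).
  rewrite -[LHS]/((1 - (x ^+ c) `^ c%:R^-1) ^+ a * (c%:R * x ^+ c.-1)).
  by rewrite powR_exprK// /XMonemX mulrCA [_ * x ^+ _]mulrC.
transitivity ((c%:R * beta_fun c a.+1)%:E : \bar R); first by rewrite EFinM EFin_beta_fun.
congr (_%:E); case: c c0 {mf dF F'E cF'} => // c _; rewrite beta_fun_fact.
have E := bin_fact (leq_addr c.+1 a); rewrite addKn in E.
have -> : (c + a).+1 = (a + c.+1)%N by rewrite addnS addnC.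
rewrite -E factS !natrM.
have := fact_gt0 c; have := fact_gt0 a; have := leq_addr c.+1 a; rewrite -bin_gt0.
rewrite -!(ltr0n R) => C0 a0 c0; have := ltr0Sn R c => c1.
by field; rewrite !gt_eqF.
Qed.

End beta_integral.

(** * Level sets and Chebyshev's integral inequality *)

Section level_lemmas.
Local Open Scope ereal_scope.
Context {R : realType}.
Notation RR := (measurableTypeR R).
Notation lam := (@lebesgue_measure R).

(** A set of positive reals of measure greater than [t0] is not contained in the interval from 0 to
    [t0]. *)
Lemma lt_level_measure (L : RR -> \bar R) (t0 v : R) : (0 <= t0)%R ->
  measurable_fun [set: RR] L -> (forall t, (t <= 0)%R -> L t <= 0) ->
  t0%:E < level_measure lam L v -> exists t, [/\ (t0 < t)%R, (0 < v)%R & v%:E < L t].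
Proof.
move=> t00 mL L0 tv; apply: contrapT => H; move: tv; apply/negP; rewrite -leNgt.
apply: (@le_trans _ _ (lam `]0%R, t0]%classic)); last first.
  rewrite [leLHS]lebesgue_measure_itv/= lte_fin oppr0 addr0.
  by case: ifPn => //; rewrite lee_fin.
apply: le_measure; rewrite ?inE//; first exact: measurable_level_set.
move=> t [v0 vL] /=; rewrite in_itv/=; apply/andP; split.
  rewrite ltNge; apply/negP => /L0; rewrite leNgt => /negP; apply.
  by apply: le_lt_trans vL; rewrite lee_fin ltW.
by rewrite leNgt; apply/negP => tt; apply: H; exists t.
Qed.

Lemma level_measure_le d (X : measurableType d) (m : {measure set X -> \bar R})
    (g : X -> \bar R) (s t : R) : measurable_fun [set: X] g -> (0 < s)%R -> (s <= t)%R ->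
  level_measure m g t <= level_measure m g s.
Proof.
move=> mg s0 st; apply: le_measure; rewrite ?inE; try exact: measurable_level_set.
move=> x [t0 tg]; split => //; apply: le_lt_trans tg; rewrite lee_fin//.
Qed.

Lemma level_measure_le0 d (X : measurableType d) (m : {measure set X -> \bar R})
    (g : X -> \bar R) (t : R) : (t <= 0)%R -> level_measure m g t = 0.
Proof.
move=> t0; rewrite /level_measure (_ : [set _ | _] = set0) ?measure0//.
by apply/seteqP; split => // x [/lt_geF]; rewrite t0.
Qed.

Lemma level_measure_eq0 d (X : measurableType d) (m : {measure set X -> \bar R})
    (g : X -> \bar R) (t : R) : (forall x, g x <= t%:E) -> level_measure m g t = 0.
Proof.
move=> gt; rewrite /level_measure (_ : [set _ | _] = set0) ?measure0//.
by apply/seteqP; split => // x [_]; rewrite ltNge gt.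
Qed.

(** Passes from the real numbers below [V] to [V] itself, absorbing the cases of zero or infinite
    factors. *)
Lemma mule_le_of_real (V K I : \bar R) : 0 <= V -> 0 <= K -> 0 <= I ->
  (forall t : R, (0 < t)%R -> t%:E < V -> t%:E * K <= I) -> V * K <= I.
Proof.
case: V => [v||//] V0 K0 I0 H; last first.
  have [->|Kn0] := eqVneq K 0; first by rewrite mule0.
  have {Kn0}K0 : 0 < K by rewrite lt0e Kn0.
  rewrite gt0_mulye//; case: I I0 H => [i||//] I0 H //; rewrite leye_eq.
  case: K K0 H => [k||//] K0 H.
    rewrite lte_fin in K0; rewrite lee_fin in I0.
    have p : (0 < i / k + 1)%R by rewrite ltr_wpDl// divr_ge0// ltW.
    have := H _ p (ltry _); rewrite -EFinM lee_fin.
    have -> : ((i / k + 1) * k = i + k)%R by field; rewrite gt_eqF.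
    by rewrite gerDl leNgt K0.
  have := H 1%R ltr01; rewrite ltry mul1e => /(_ isT).
  by rewrite leye_eq.
have [v0|v0] := leP v 0%R.
  have -> : v = 0%R by apply/eqP; rewrite eq_le v0 -lee_fin.
  by rewrite mul0e.
apply/lee_mul01Pr; first by rewrite mule_ge0.
move=> r /andP[r0 r1]; rewrite muleA -EFinM; apply: H; first exact: mulr_gt0.
by rewrite lte_fin gtr_pMl.
Qed.

(** This is [0 <= (v1 - v2) * (a1 - a2)], written without differences because the values may be
    infinite. *)
Lemma mule_rearrange (v1 v2 a1 a2 : \bar R) : 0 <= v2 -> 0 <= a2 ->
  v2 <= v1 -> a2 <= a1 -> v1 * a2 + v2 * a1 <= v1 * a1 + v2 * a2.
Proof.
move=> v20 a20 v21 a21.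
have v10 := le_trans v20 v21; have a10 := le_trans a20 a21.
have le0 (x y : \bar R) : 0 <= x -> x <= y -> y = 0 -> x = 0.
  by move=> x0 xy yE; apply/eqP; rewrite eq_le x0 andbT -yE.
have [v1E|v1n0] := eqVneq v1 0.
  by rewrite v1E (le0 _ _ v20 v21 v1E) !mul0e.
have [a1E|a1n0] := eqVneq a1 0.
  by rewrite a1E (le0 _ _ a20 a21 a1E) !mule0.
have v1gt0 : 0 < v1 by rewrite lt0e v1n0.
have a1gt0 : 0 < a1 by rewrite lt0e a1n0.
have [->|v1oo] := eqVneq v1 +oo.
  by rewrite [X in _ <= X + _]gt0_mulye// addye ?leey// gt_eqF// (lt_le_trans _ (mule_ge0 v20 a20)).
have [->|a1oo] := eqVneq a1 +oo.
  by rewrite [X in _ <= X + _]gt0_muley// addye ?leey// gt_eqF// (lt_le_trans _ (mule_ge0 v20 a20)).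
have fin (x y : \bar R) : 0 <= x -> x <= y -> y != +oo -> x \is a fin_num.
  by move=> x0 xy yoo; rewrite ge0_fin_numE// (le_lt_trans xy)// lt_neqAle yoo leey.
move: (v21) (a21) (fin _ _ v20 v21 v1oo) (fin _ _ v10 (lexx _) v1oo) (fin _ _ a20 a21 a1oo)
  (fin _ _ a10 (lexx _) a1oo).
case: v1 {v10 v21 v1n0 v1gt0 v1oo} => // v1; case: v2 {v20} => // v2.
case: a1 {a10 a21 a1n0 a1gt0 a1oo} => // a1; case: a2 {a20} => // a2.
rewrite !lee_fin => v a _ _ _ _; nra.
Qed.

(** The rearrangement inequality is integrated over pairs of levels [s], [t] between 0 and [M];
    outside this range both functions vanish, so the left side loses nothing. *)
Lemma chebyshev_integral (V A : RR -> \bar R) (M : \bar R) :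
  measurable_fun [set: RR] V -> measurable_fun [set: RR] A ->
  (forall t, 0 <= V t) -> (forall t, 0 <= A t) ->
  (forall t, (t <= 0)%R -> V t = 0) -> (forall t, (t <= 0)%R -> A t = 0) ->
  (forall s t, (0 < s)%R -> (s <= t)%R -> V t <= V s) ->
  (forall s t, (0 < s)%R -> (s <= t)%R -> A t <= A s) ->
  0 <= M ->
  (forall t, M <= t%:E -> V t = 0) -> (forall t, M <= t%:E -> A t = 0) ->
  (\int[lam]_t V t) * (\int[lam]_t A t) <= M * \int[lam]_t (V t * A t).
Proof.
move=> mV mA V0 A0 Vn An dV dA M0 VM AM.
have mVA : measurable_fun [set: RR] (fun t => V t * A t) by exact: emeasurable_funM.
have VA0 t : 0 <= V t * A t by rewrite mule_ge0.
(* For infinite [M], only a vanishing integral on the right is in question. If neither function were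
   zero, monotonicity would bound both below by positive constants on a common interval starting at
   0. *)
case: M M0 VM AM => [m||//] M0 VM AM; last first.
  have [I0|In0] := eqVneq (\int[lam]_t (V t * A t)) 0; last first.
    by rewrite gt0_mulye ?leey// lt0e In0 integral_ge0.
  rewrite I0 mule0.
  have zero (f : RR -> \bar R) : (forall t, 0 <= f t) -> ~ (exists t, 0 < f t) ->
      \int[lam]_t f t = 0.
    move=> f0 H; apply: integral0_eq => t _; apply/eqP; rewrite eq_le f0 andbT.
    by rewrite leNgt; apply/negP => ft; apply: H; exists t.
  have [[s Vs]|/(zero _ V0) ->] := pselect (exists s, 0 < V s); last by rewrite mul0e.
  have [[t At]|/(zero _ A0) ->] := pselect (exists t, 0 < A t); last by rewrite mule0.
  have s0 : (0 < s)%R by rewrite ltNge; apply/negP => /Vn E; rewrite E ltxx in Vs.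
  have t0 : (0 < t)%R by rewrite ltNge; apply/negP => /An E; rewrite E ltxx in At.
  pose u := Num.min s t; have u0 : (0 < u)%R by rewrite lt_min s0.
  pose J : set RR := `]0%R, u]%classic.
  have mJ : measurable J by exact: measurable_itv.
  have : \int[lam]_x ((\1_J x)%:E * (V s * A t)) <= \int[lam]_t (V t * A t).
    apply: ge0_le_integral => //.
    - by move=> x _; rewrite mule_ge0// ?lee_fin// mule_ge0.
    - apply: emeasurable_funM; last exact: measurable_cst.
      by apply/measurable_EFinP; exact: measurable_indic.
    - move=> x _; rewrite indicE; case: (boolP (x \in J)) => [|_]; last by rewrite mul0e.
      rewrite inE /J /= in_itv/= le_min mul1e => /and3P[x0 xs xt].
      by apply: lee_pmul => //; [exact: dV|exact: dA].
  rewrite I0 ge0_integralZr//; last 2 first.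
  - by apply/measurable_EFinP; exact: measurable_indic.
  - by rewrite mule_ge0.
  have -> : \int[lam]_x (\1_J x)%:E = u%:E.
    by rewrite integral_indic// setIT [LHS]lebesgue_measure_itv/= lte_fin u0 oppr0 addr0.
  rewrite leNgt => /negP; case; rewrite mule_gt0//; exact: mule_gt0.
pose J : set RR := `]0%R, m[%classic.
have mJ : measurable J by exact: measurable_itv.
have JE : \int[lam]_x (\1_J x)%:E = m%:E.
  rewrite integral_indic// setIT [LHS]lebesgue_measure_itv/= lte_fin oppr0 addr0.
  case: ifPn => //; rewrite -leNgt => m0; congr (_%:E); apply/eqP.
  by rewrite eq_le m0 andbT -lee_fin.
have outJ (f : RR -> \bar R) t : (forall t, (t <= 0)%R -> f t = 0) ->
    (forall t, m%:E <= t%:E -> f t = 0) -> ~ J t -> f t = 0.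
  move=> fn fM; rewrite /J /= in_itv/= => /negP; rewrite negb_and -!leNgt.
  by move=> /orP[/fn//|tm]; apply: fM; rewrite lee_fin.
have mind : measurable_fun [set: RR] (fun t : RR => (\1_J t : R)%:E).
  by apply/measurable_EFinP; exact: measurable_indic.
have ind0 t : 0 <= (\1_J t : R)%:E by rewrite lee_fin.
set P := \int[lam]_t V t; set Q := \int[lam]_t A t; set I := \int[lam]_t _.
have P0 : 0 <= P by exact: integral_ge0.
have Q0 : 0 <= Q by exact: integral_ge0.
have I0 : 0 <= I by exact: integral_ge0.
(* The indicators confine the integral of each term that is constant in one variable to an interval
   of length [m]. *)
have pt s t : V s * A t + V t * A s <=
    (\1_J t)%:E * (V s * A s) + (\1_J s)%:E * (V t * A t).
  have R0 : 0 <= (\1_J t)%:E * (V s * A s) + (\1_J s)%:E * (V t * A t).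
    by rewrite adde_ge0// mule_ge0.
  have [Js|nJs] := pselect (J s); last first.
    by have -> : V s * A t + V t * A s = 0
      by rewrite (outJ V s)// (outJ A s)// mul0e mule0 adde0.
  have [Jt|nJt] := pselect (J t); last first.
    by have -> : V s * A t + V t * A s = 0
      by rewrite (outJ V t)// (outJ A t)// mul0e mule0 adde0.
  rewrite !indicE !mem_set// !mul1e.
  move: Js Jt; rewrite /J /= !in_itv/= => /andP[s0 _] /andP[t0 _].
  have [st|ts] := leP s t; first by apply: mule_rearrange => //; [exact: dV|exact: dA].
  rewrite addeC [leRHS]addeC.
  by apply: mule_rearrange => //; [exact: dV (ltW ts)|exact: dA (ltW ts)].
have int1 s : \int[lam]_t (V s * A t + V t * A s) = V s * Q + P * A s.
  rewrite ge0_integralD//; first last.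
  - by apply: emeasurable_funM => //; exact: measurable_cst.
  - by move=> t _; exact: mule_ge0.
  - by apply: emeasurable_funM => //; exact: measurable_cst.
  - by move=> t _; exact: mule_ge0.
  by rewrite ge0_integralZl// ge0_integralZr.
have int2 s : \int[lam]_t ((\1_J t)%:E * (V s * A s) + (\1_J s)%:E * (V t * A t)) =
    m%:E * (V s * A s) + (\1_J s)%:E * I.
  rewrite ge0_integralD//; first last.
  - by apply: emeasurable_funM => //; exact: measurable_cst.
  - by move=> t _; exact: mule_ge0.
  - by apply: emeasurable_funM => //; exact: measurable_cst.
  - by move=> t _; exact: mule_ge0.
  by rewrite ge0_integralZl// ge0_integralZr// JE.
have : \int[lam]_s (V s * Q + P * A s) <=
    \int[lam]_s (m%:E * (V s * A s) + (\1_J s)%:E * I).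
  apply: ge0_le_integral => //.
  - by move=> s _; rewrite adde_ge0// mule_ge0.
  - by apply: emeasurable_funD; apply: emeasurable_funM => //; exact: measurable_cst.
  - by apply: emeasurable_funD; apply: emeasurable_funM => //; exact: measurable_cst.
  - move=> s _; rewrite -int1 -int2; apply: ge0_le_integral => //.
    + by move=> t _; rewrite adde_ge0// mule_ge0.
    + by apply: emeasurable_funD; apply: emeasurable_funM => //; exact: measurable_cst.
    + by apply: emeasurable_funD; apply: emeasurable_funM => //; exact: measurable_cst.
rewrite ge0_integralD//; first last.
- by apply: emeasurable_funM => //; exact: measurable_cst.
- by move=> t _; exact: mule_ge0.
- by apply: emeasurable_funM => //; exact: measurable_cst.
- by move=> t _; exact: mule_ge0.
rewrite ge0_integralZr// ge0_integralZl// -/P -/Q.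
rewrite ge0_integralD//; first last.
- by apply: emeasurable_funM => //; exact: measurable_cst.
- by move=> t _; exact: mule_ge0.
- by apply: emeasurable_funM => //; exact: measurable_cst.
- by move=> t _; exact: mule_ge0.
rewrite ge0_integralZl// ge0_integralZr// -/I JE.
(* Both sides are doubled; arguing by contradiction halves them without dividing in [\bar R]. *)
by move=> PQ; rewrite leNgt; apply/negP => lt; move: PQ; apply/negP; rewrite -ltNge lteD.
Qed.

End level_lemmas.

(** * Decreasing rearrangements *)

Section rearrangement.
Local Open Scope ereal_scope.
Context {R : realType}.
Notation RR := (measurableTypeR R).
Notation lam := (@lebesgue_measure R).

(* Decreasing rearrangement as a function of the volume [v]: the radial profile
   of the Schwarz symmetrization of [g]. *)
Definition rearrangement d (X : measurableType d) (m : set X -> \bar R)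
    (g : X -> \bar R) (v : R) : \bar R :=
  level_measure lam (level_measure m g : RR -> \bar R) v.

Context d (X : measurableType d) d' (Y : measurableType d').
Context (m : {sigma_finite_measure set X -> \bar R}).
Context (n : {sigma_finite_measure set Y -> \bar R}).

Lemma measurable_level_measure1 (g : X -> \bar R) : measurable_fun [set: X] g ->
  measurable_fun [set: RR] (level_measure m g).
Proof.
move=> mg; have mg' : measurable_fun [set: RR * X] (g \o snd).
  by apply: measurableT_comp => //; exact: measurable_snd.
have H := measurable_level_measure m mg'.
exact: (measurableT_comp H (measurable_pair1 (0%R : RR))).
Qed.

(** Two layer cakes: one for [g], one for its distribution function. *)
Lemma integral_rearrangement (g : X -> \bar R) : measurable_fun [set: X] g ->
  (forall x, 0 <= g x) -> \int[m]_x g x = \int[lam]_v rearrangement m g v.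
Proof.
move=> mg g0; rewrite (integral_level_measure m)// (integral_level_measure lam)//.
by apply: measurable_level_measure1.
Qed.

Lemma measurable_rearrangement (g : Y * X -> \bar R) : measurable_fun [set: Y * X] g ->
  measurable_fun [set: Y * RR] (fun p => rearrangement m (fun x => g (p.1, x)) p.2).
Proof.
move=> mg; have := measurable_level_measure m mg => /(measurable_level_measure lam).
exact.
Qed.

Lemma rearrangement_ge0 (g : X -> \bar R) v : 0 <= rearrangement m g v.
Proof. exact: measure_ge0. Qed.

Lemma rearrangement_le0 (g : X -> \bar R) v : (v <= 0)%R -> rearrangement m g v = 0.
Proof. exact: level_measure_le0. Qed.

(** Together with [rearrangement_ge], this replaces the inverse-function relation between a
    rearrangement and the distribution function. *)
Lemma lt_rearrangement (g : X -> \bar R) (t0 v : R) : (0 <= t0)%R ->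
  measurable_fun [set: X] g -> t0%:E < rearrangement m g v ->
  exists t, [/\ (t0 < t)%R, (0 < v)%R & v%:E < level_measure m g t].
Proof.
move=> t00 mg; apply: lt_level_measure => //; first exact: measurable_level_measure1.
by move=> t tle0; rewrite level_measure_le0.
Qed.

Lemma rearrangement_ge (g : X -> \bar R) (t0 v : R) : measurable_fun [set: X] g ->
  (0 < t0)%R -> (0 < v)%R -> v%:E < level_measure m g t0 -> t0%:E <= rearrangement m g v.
Proof.
move=> mg t00 v0 vt.
apply: (@le_trans _ _ (lam `]0%R, t0]%classic)).
  by rewrite [leRHS]lebesgue_measure_itv/= lte_fin t00 oppr0 addr0.
apply: le_measure; rewrite ?inE//.
  by apply: measurable_level_set; exact: measurable_level_measure1.
move=> t /=; rewrite in_itv/= => /andP[tgt0 tt0]; split => //.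
by apply: (lt_le_trans vt); exact: level_measure_le.
Qed.

End rearrangement.

(** * Cone-shaped lower bounds and the binomial constant *)

Section radial.
Local Open Scope ereal_scope.
Context {R : realType}.
Notation RR := (measurableTypeR R).
Notation lam := (@lebesgue_measure R).
Notation T n := (n.-tuple (measurableTypeR R)).
Notation mu n := (@borel_lebesgue R n).

Definition zero_tuple n : T n := [tuple 0%R | i < n].

Lemma tuple_conv_affineE n (l : R) (x y : T n) :
  tuple_conv l x y = tuple_affine (1 - l)%R (tuple_affine l (zero_tuple n) y) x.
Proof.
apply: eq_from_tnth => i; rewrite !tnth_mktuple addr0//.
Qed.

Lemma tuple_conv0E n (l : R) (x : T n) :
  tuple_conv l (zero_tuple n) x = tuple_affine l (zero_tuple n) x.
Proof. by apply: eq_from_tnth => i; rewrite !tnth_mktuple mulr0 add0r addr0. Qed.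

Variables (a c : nat).
Hypothesis c0 : (0 < c)%N.
(** [Nr] plays the part of the profile [N] at 0 but is kept separate: it will come from a minorant
    of [f] on H, whereas [N] will come from a majorant of [f]. *)
Variables (N : T a -> R -> \bar R) (Nr : R -> \bar R) (G : T a -> \bar R) (M : \bar R).
Hypothesis (mN : measurable_fun [set: T a * RR] (fun q => N q.1 q.2))
  (mNr : measurable_fun [set: RR] Nr) (mG : measurable_fun [set: T a] G).
Hypothesis (N0 : forall x w, 0 <= N x w) (Nr0 : forall w, 0 <= Nr w)
  (G0 : forall x, 0 <= G x).
Hypothesis (Nr_le0 : forall w, (w <= 0)%R -> Nr w <= 0).
Hypothesis (Nr_le : forall w, Nr w <= M) (G_le : forall x, G x <= M).
Hypothesis N_gt : forall x (l v t : R), (0 < l < 1)%R -> (0 < v)%R -> (0 < t)%R ->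
  t%:E < Nr v -> t%:E < G x -> t%:E < N (tuple_conv l (zero_tuple a) x) ((1 - l) ^+ c * v).

Let A (t : R) := level_measure (mu a) G t.
Let V (t : R) := level_measure lam (Nr : RR -> \bar R) t.
Let Phi (t w : R) := level_measure (mu a) (fun x => N x w) t.

Let A0 t : 0 <= A t. Proof. exact: measure_ge0. Qed.
Let V0 t : 0 <= V t. Proof. exact: measure_ge0. Qed.

Let mNw (w : R) : measurable_fun [set: T a] (fun x => N x w).
Proof. exact: (measurableT_comp mN (measurable_pair2 (w : RR))). Qed.

Let mPhi : measurable_fun [set: RR * RR] (fun q => Phi q.2 q.1).
Proof.
have mN' : measurable_fun [set: RR * T a] (fun q => N q.2 q.1).
  have msw : measurable_fun [set: RR * T a] (fun q => (q.2, q.1)).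
    by apply: measurable_fun_pair; [exact: measurable_snd|exact: measurable_fst].
  exact: (measurableT_comp mN msw).
exact: (measurable_level_measure (mu a) mN').
Qed.

(** With [1 - l] equal to the [c]-th root of [w / v], one has [(1 - l) ^+ c * v = w], so [N_gt]
    lands exactly at [w]; shrinking by [l] in dimension [a] costs the factor [l ^+ a]. *)
Let slice (t v w : R) : (0 < t)%R -> t%:E < Nr v -> (0 < w)%R -> (w < v)%R ->
  ((1 - (w / v) `^ c%:R^-1) ^+ a)%:E * A t <= Phi t w.
Proof.
move=> t0 tN w0 wv; have v0 := lt_trans w0 wv.
have wv0 : (0 < w / v)%R by rewrite divr_gt0.
have wv1 : (w / v < 1)%R by rewrite ltr_pdivrMr// mul1r.
pose q := ((w / v) `^ c%:R^-1)%R; have q0 : (0 < q)%R by rewrite powR_gt0.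
have qc : (q ^+ c = w / v)%R by rewrite exprK_powR// ltW.
have q1 : (q < 1)%R.
  rewrite ltNge; apply/negP => q1; move: wv1; rewrite -qc ltNge => /negP; apply.
  exact: exprn_ege1.
rewrite -/q; set l := (1 - q)%R; have l01 : (0 < l < 1)%R.
  by rewrite /l subr_gt0 q1 gtrBl.
have lq : (1 - l = q)%R by rewrite /l; ring.
rewrite /A /Phi /level_measure.
rewrite -[leRHS](@borel_lebesgue_tuple_affine _ _ l (zero_tuple a)); first last.
- exact: measurable_level_set.
- by rewrite gt_eqF//; case/andP: l01.
rewrite gtr0_norm; last by case/andP: l01.
apply: lee_wpmul2l; first by rewrite lee_fin exprn_ge0// ltW//; case/andP: l01.
apply: le_measure; rewrite ?inE.
- exact: measurable_level_set.
- rewrite -[X in measurable X]setTI; apply: measurable_tuple_affine => //.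
  exact: measurable_level_set.
- move=> x [_ tG] /=; split => //; have := N_gt l01 v0 t0 tN tG.
  by rewrite tuple_conv0E lq qc divfK// gt_eqF.
Qed.

(* By [slice], the level set of [N _ w] contains the level set of [G] shrunk by
   the factor 1 - (w / v)^(1/c); the beta integral over w gives the binomial. *)
Let level_product (t : R) : (0 < t)%R ->
  V t * A t <= ('C(a + c, a)%:R)%:E * \int[lam]_w Phi t w.
Proof.
move=> t0; have I0 : 0 <= \int[lam]_w Phi t w by exact: integral_ge0.
have C0 : (0 < 'C(a + c, a)%:R :> R)%R by rewrite ltr0n bin_gt0 leq_addr.
apply: mule_le_of_real => //; first by rewrite mule_ge0// lee_fin ltW.
move=> u u0 uV.
(* Any [u] below [V t] lies below some [v] with [t < Nr v]; integrating [slice] over [0 < w < v] is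
   then enough. *)
have [v [uv _ tN]] := lt_level_measure (ltW u0) mNr Nr_le0 uV.
have v0 := lt_trans u0 uv.
pose J : set RR := `]0%R, 1%R[%classic.
pose psi (x : R) : \bar R := ((1 - x `^ c%:R^-1) ^+ a)%:E.
have mpsi : measurable_fun [set: RR] (psi \_ J).
  apply/measurable_restrict => //; first exact: measurable_itv.
  rewrite setTI; apply/measurable_EFinP.
  apply: (@measurable_funS _ _ _ _ (`[0%R, 1%R]%classic : set RR)) => //.
    by move=> x /=; rewrite !in_itv/= => /andP[x0 x1]; rewrite !ltW.
  by apply: subspace_continuous_measurable_fun => //; exact: within_continuous_root.
have psi0 x : 0 <= (psi \_ J) x.
  rewrite patchE; case: ifPn => //; rewrite inE /J /= in_itv/= => /andP[x0 x1].
  have cV0 : (0 <= c%:R^-1 :> R)%R by rewrite invr_ge0.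
  have : (x `^ c%:R^-1 <= 1 `^ c%:R^-1)%R.
    by apply: ge0_ler_powR => //; rewrite ?nnegrE ?ltW.
  by rewrite powR1 lee_fin => ?; rewrite exprn_ge0// subr_ge0.
have mpsiv : measurable_fun [set: RR] (fun w : RR => (psi \_ J) (v^-1 * w + 0)%R).
  exact: (measurableT_comp mpsi (measurable_affine1 _ _)).
have le : \int[lam]_w ((psi \_ J) (v^-1 * w + 0)%R * A t) <= \int[lam]_w Phi t w.
  apply: ge0_le_integral => //.
  - by move=> w _; rewrite mule_ge0.
  - by apply: emeasurable_funM => //; exact: measurable_cst.
  - exact: (measurableT_comp mPhi (measurable_pair2 (t : RR))).
  - move=> w _; rewrite patchE addr0 mulrC; case: ifPn => [|_]; last by rewrite mul0e.
    rewrite inE /J /= in_itv/= ltr_pdivlMr// mul0r ltr_pdivrMr// mul1r => /andP[w0 wv].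
    exact: slice.
rewrite ge0_integralZr// in le.
(* The substitution [w = v * x] produces the beta integral and leaves [v] divided by the
   binomial. *)
have E := @ge0_integral_affine R v^-1 0 _ _ mpsi psi0.
rewrite -[X in _ = X]integral_mkcond integral_root_beta// in E.
have {}E : \int[lam]_x (psi \_ J) (v^-1 * x + 0)%R = (v / 'C(a + c, a)%:R)%:E.
  have := E (invr_neq0 (lt0r_neq0 v0)); rewrite gtr0_norm ?invr_gt0// => {}E.
  by rewrite EFinM -E muleA -EFinM divff ?gt_eqF// mul1e.
rewrite E in le.
apply: (@le_trans _ _ (v%:E * A t)).
  by apply: lee_wpmul2r => //; rewrite lee_fin ltW.
apply: le_trans (lee_wpmul2l _ le); last by rewrite lee_fin ltW.
by rewrite muleA -EFinM mulrCA divff ?mulr1// gt_eqF.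
Qed.

Lemma radial_inequality :
  (\int[mu a]_x G x) * (\int[lam]_w Nr w) <=
  ('C(a + c, a)%:R)%:E * M * \int[mu a]_x \int[lam]_w N x w.
Proof.
have M0 : 0 <= M by apply: le_trans (G_le (zero_tuple a)).
have mPhi' : measurable_fun [set: RR] (fun t : RR => \int[lam]_w Phi t w).
  exact: (measurable_fun_fubini_tonelli_G (fun q : RR * RR => Phi q.2 q.1)).
(* The layer cake formula is used in [x] at fixed [w], and the level [t] is then moved outermost. *)
have -> : \int[mu a]_x \int[lam]_w N x w = \int[lam]_t \int[lam]_w Phi t w.
  rewrite (fubini_tonelli (fun q : T a * RR => N q.1 q.2))//=.
  transitivity (\int[lam]_w \int[lam]_t Phi t w).
    by apply: eq_integral => w _; exact: integral_level_measure.
  exact: (fubini_tonelli (fun q : RR * RR => Phi q.2 q.1)).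
have -> : \int[mu a]_x G x = \int[lam]_t A t by exact: integral_level_measure.
have -> : \int[lam]_w Nr w = \int[lam]_t V t by exact: integral_level_measure.
have mV : measurable_fun [set: RR] V by exact: measurable_level_measure1.
have mA : measurable_fun [set: RR] A by exact: measurable_level_measure1.
rewrite muleC; apply: (@le_trans _ _ (M * \int[lam]_t (V t * A t))).
  apply: chebyshev_integral => //.
  - by move=> t; exact: level_measure_le0.
  - by move=> t; exact: level_measure_le0.
  - by move=> u t; exact: level_measure_le.
  - by move=> u t; exact: level_measure_le.
  - by move=> t Mt; apply: level_measure_eq0 => w; exact: le_trans Mt.
  - by move=> t Mt; apply: level_measure_eq0 => x; exact: le_trans Mt.
rewrite (muleC _ M) -muleA; apply: lee_wpmul2l => //.
rewrite -ge0_integralZl//; last by move=> t _; exact: integral_ge0.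
apply: ge0_le_integral => //.
- by move=> t _; rewrite mule_ge0.
- exact: emeasurable_funM.
- by apply: emeasurable_funM => //; exact: measurable_cst.
- move=> t _; have [t0|t0] := leP t 0%R; last exact: level_product.
  rewrite [A t]level_measure_le0// mule0 mule_ge0 ?lee_fin ?ler0n//.
  exact: integral_ge0.
Qed.

End radial.

(** * Symmetrization along the fibres *)

Section core.
Local Open Scope ereal_scope.
Context {R : realType}.
Notation RR := (measurableTypeR R).
Notation lam := (@lebesgue_measure R).
Notation T n := (n.-tuple (measurableTypeR R)).
Notation mu n := (@borel_lebesgue R n).

Variables (a k c : nat).
Hypothesis c0 : (0 < c)%N.
Variables (F : (T a * T k) * T c -> \bar R) (s : T a * T k -> \bar R)
  (r : T k * T c -> \bar R) (M : \bar R).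
Hypothesis (mF : measurable_fun [set: (T a * T k) * T c] F)
  (ms : measurable_fun [set: T a * T k] s) (mr : measurable_fun [set: T k * T c] r).
Hypothesis (F0 : forall p, 0 <= F p) (s0 : forall p, 0 <= s p) (r0 : forall p, 0 <= r p).
(** The near-maximiser [z1] is chosen before [l], [b0] and [z0], so for given [l] a single affine
    map carries the whole level set of [r (b0, _)] into one of [F]. *)
Hypothesis F_ge : forall x b1 (t1 : R), (0 < t1)%R -> t1%:E < s (x, b1) ->
  exists z1, forall (l : R) b0 z0 (t0 : R), (0 < l < 1)%R -> (0 < t0)%R ->
    t0%:E < r (b0, z0) ->
    (t0 `^ (1 - l) * t1 `^ l)%:E <
    F ((tuple_conv l (zero_tuple a) x, tuple_conv l b0 b1), tuple_conv l z0 z1).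
Hypothesis s_le : forall x, \int[mu k]_b s (x, b) <= M.
(** A bound on the integral over [b] of the supremum of [r (b, _)]. That supremum may fail to be
    measurable, so it is tested through measurable functions [p] below it. *)
Hypothesis r_le : forall p : T k -> \bar R, measurable_fun [set: T k] p ->
  (forall b, 0 <= p b) ->
  (forall b (t : R), (0 < t)%R -> t%:E < p b -> exists z, t%:E < r (b, z)) ->
  \int[mu k]_b p b <= M.

Let Fs (p : T a * T k) (w : R) := rearrangement (mu c) (fun z => F (p, z)) w.
Let rs (b : T k) (w : R) := rearrangement (mu c) (fun z => r (b, z)) w.
Let N (x : T a) (w : R) := \int[mu k]_b Fs (x, b) w.
Let Nr (w : R) := \int[mu k]_b rs b w.
Let G (x : T a) := \int[mu k]_b s (x, b).

Let mF1 p : measurable_fun [set: T c] (fun z => F (p, z)).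
Proof. exact: (measurableT_comp mF (measurable_pair1 p)). Qed.

Let mr1 b : measurable_fun [set: T c] (fun z => r (b, z)).
Proof. exact: (measurableT_comp mr (measurable_pair1 b)). Qed.

Let mFs : measurable_fun [set: (T a * T k) * RR] (fun p => Fs p.1 p.2).
Proof. exact: measurable_rearrangement. Qed.

Let mrs : measurable_fun [set: T k * RR] (fun p => rs p.1 p.2).
Proof. exact: measurable_rearrangement. Qed.

Let mFs' : measurable_fun [set: (T a * RR) * T k] (fun q => Fs (q.1.1, q.2) q.1.2).
Proof.
have mf : measurable_fun setT (fun q : (T a * RR) * T k => ((q.1.1, q.2), q.1.2)).
  apply: measurable_fun_pair; [apply: measurable_fun_pair|].
  - exact: (measurableT_comp measurable_fst measurable_fst).
  - exact: measurable_snd.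
  - exact: (measurableT_comp measurable_snd measurable_fst).
exact: (measurableT_comp mFs mf).
Qed.

Let mN : measurable_fun [set: T a * RR] (fun q => N q.1 q.2).
Proof.
apply: (measurable_fun_fubini_tonelli_F (fun q : (T a * RR) * T k => Fs (q.1.1, q.2) q.1.2)) => //.
Qed.

Let mNr : measurable_fun [set: RR] Nr.
Proof.
apply: (measurable_fun_fubini_tonelli_G (fun q : T k * RR => rs q.1 q.2)) => //.
Qed.

Let mG : measurable_fun [set: T a] G.
Proof. exact: (measurable_fun_fubini_tonelli_F s). Qed.

(* The [mu c]-section of [F] contains an affine copy of that of [r], scaled by
   the factor [1 - l]. *)
Let scaling x b0 b1 z1 (l t0 t1 : R) : (0 < l < 1)%R -> (0 < t0)%R -> (0 < t1)%R ->
  (forall z0, t0%:E < r (b0, z0) -> (t0 `^ (1 - l) * t1 `^ l)%:E <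
     F ((tuple_conv l (zero_tuple a) x, tuple_conv l b0 b1), tuple_conv l z0 z1)) ->
  ((1 - l) ^+ c)%:E * level_measure (mu c) (fun z => r (b0, z)) t0 <=
  level_measure (mu c) (fun z => F ((tuple_conv l (zero_tuple a) x, tuple_conv l b0 b1), z))
    (t0 `^ (1 - l) * t1 `^ l).
Proof.
move=> /andP[l0 l1] t00 t10 H; have l10 : (0 < 1 - l)%R by rewrite subr_gt0.
set p := (_, _) in H *; set t := (_ * _)%R in H *.
have t_gt0 : (0 < t)%R by rewrite mulr_gt0 ?powR_gt0.
rewrite /level_measure.
rewrite -[leRHS](@borel_lebesgue_tuple_affine _ _ (1 - l)%R (tuple_affine l (zero_tuple c) z1)).
- rewrite gtr0_norm//; apply: lee_wpmul2l; first by rewrite lee_fin exprn_ge0// ltW.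
  apply: le_measure; rewrite ?inE.
  + exact: measurable_level_set.
  + rewrite -[X in measurable X]setTI; apply: measurable_tuple_affine => //.
    exact: measurable_level_set.
  + move=> z [_ tz] /=; split => //.
    by have := H _ tz; rewrite tuple_conv_affineE.
- by rewrite gt_eqF.
- exact: measurable_level_set.
Qed.

(** Prekopa-Leindler in [b]. Its pointwise hypothesis holds since a rearrangement above [u0] at [v]
    means a level set of volume greater than [v], and [scaling] turns this into a level set of [F]
    of volume greater than [(1 - l) ^+ c * v]. *)
Let N_gt x (l v t : R) : (0 < l < 1)%R -> (0 < v)%R -> (0 < t)%R ->
  t%:E < Nr v -> t%:E < G x -> t%:E < N (tuple_conv l (zero_tuple a) x) ((1 - l) ^+ c * v).
Proof.
move=> l01 v0 t0 tN tG; have /andP[l0 l1] := l01.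
have l10 : (0 < 1 - l)%R by rewrite subr_gt0.
have lc0 : (0 < (1 - l) ^+ c)%R by rewrite exprn_gt0.
(* Both hypotheses are at the level [t], whose weighted geometric mean with itself is [t]. *)
have -> : t = (t `^ (1 - l) * t `^ l)%R.
  rewrite -powRD ?subrK ?powRr1// ?ltW//; by rewrite (gt_eqF t0) implybT.
apply: (geometric_bound_lt l01 _ t0 t0 tN tG).
apply: (prekopa_leindler l01).
- exact: (measurableT_comp mrs (measurable_pair2 (v : RR))).
- exact: (measurableT_comp ms (measurable_pair1 x)).
- exact: (measurableT_comp mFs' (measurable_pair1 (_, _))).
- by move=> b; exact: rearrangement_ge0.
- by [].
- by move=> b; exact: rearrangement_ge0.
move=> b0 b1 u0 u1 u00 u10 ru su.
have [t' [ut' _ vt']] := lt_rearrangement (ltW u00) (mr1 b0) ru.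
have vu : v%:E < level_measure (mu c) (fun z => r (b0, z)) u0.
  by apply: (lt_le_trans vt'); apply: level_measure_le => //; exact: ltW.
have [z1 Hz1] := F_ge u10 su.
have := scaling l01 u00 u10 (fun z0 => Hz1 l b0 z0 u0 l01 u00) => Hsc.
apply: rearrangement_ge => //; rewrite ?mulr_gt0 ?powR_gt0//.
apply: lt_le_trans Hsc; rewrite EFinM lte_pmul2l//.
Qed.

(* [s] and [r] stand for Borel minorants of P_E f on E and of f on H, and [F]
   for a Borel majorant of f: the functions themselves need not be Borel. *)
Lemma sections_projections_borel :
  (\int[mu a]_x \int[mu k]_b s (x, b)) * (\int[mu k]_b \int[mu c]_z r (b, z)) <=
  ('C(a + c, a)%:R)%:E * M * \int[mu a]_x \int[mu k]_b \int[mu c]_z F ((x, b), z).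
Proof.
have -> : \int[mu a]_x \int[mu k]_b \int[mu c]_z F ((x, b), z) =
    \int[mu a]_x \int[lam]_w N x w.
  apply: eq_integral => x _.
  transitivity (\int[mu k]_b \int[lam]_w Fs (x, b) w).
    by apply: eq_integral => b _; exact: integral_rearrangement.
  have mFsx : measurable_fun [set: T k * RR] (fun q => Fs (x, q.1) q.2).
    have mf : measurable_fun setT (fun q : T k * RR => ((x, q.1), q.2)).
      apply: measurable_fun_pair; last exact: measurable_snd.
      by apply: measurable_fun_pair; [exact: measurable_cst|exact: measurable_fst].
    exact: (measurableT_comp mFs mf).
  apply: (fubini_tonelli (fun q : T k * RR => Fs (x, q.1) q.2)) => //.
have -> : \int[mu k]_b \int[mu c]_z r (b, z) = \int[lam]_w Nr w.
  transitivity (\int[mu k]_b \int[lam]_w rs b w).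
    by apply: eq_integral => b _; exact: integral_rearrangement.
  exact: (fubini_tonelli (fun q : T k * RR => rs q.1 q.2)).
apply: (radial_inequality c0 mN mNr mG _ _ _ _ _ s_le N_gt).
- by move=> x w; apply: integral_ge0 => b _; exact: rearrangement_ge0.
- by move=> w; apply: integral_ge0 => b _; exact: rearrangement_ge0.
- by move=> x; exact: integral_ge0.
- by move=> w w0; rewrite /Nr integral0_eq// => b _; exact: rearrangement_le0.
move=> w; apply: r_le.
- exact: (measurableT_comp mrs (measurable_pair2 (w : RR))).
- by move=> b; exact: rearrangement_ge0.
(* A rearrangement above [t] forces a level set of positive measure, hence a point: it is bounded by
   the supremum over the fibre. *)
move=> b t t0 tr; have [t' [tt' w0 wt']] := lt_rearrangement (ltW t0) (mr1 b) tr.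
apply: contrapT => H; move: wt'; rewrite level_measure_eq0 ?lte_fin ?ltNge ?(ltW w0)// => z.
rewrite leNgt; apply/negP => t'z; apply: H; exists z.
by apply: lt_trans t'z; rewrite lte_fin.
Qed.

End core.

(** * Gram determinants and orthogonal decompositions *)

Section gram_matrices.
Context {R : realType}.

Lemma row_dot_gt0 n (w : 'rV[R]_n) : w != 0 -> 0 < (w *m w^T) 0 0.
Proof.
move=> w0; have [i wi] : exists i, w 0 i != 0.
  apply/existsP; apply: contraR w0; rewrite negb_exists => /forallP h.
  by apply/eqP/rowP => i; apply/eqP; have := h i; rewrite negbK mxE.
rewrite mxE (bigD1 i)//= ltr_pwDl//.
  by rewrite mxE -expr2 exprn_even_gt0.
by apply: sumr_ge0 => j _; rewrite mxE -expr2 sqr_ge0.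
Qed.

Lemma row_dot_eq0 n (w : 'rV[R]_n) : w *m w^T = 0 -> w = 0.
Proof.
move=> ww; apply/eqP; apply: contraT => /row_dot_gt0.
by rewrite ww mxE ltxx.
Qed.

Lemma det_gram_col_mx m p n (U : 'M[R]_(m, n)) (V : 'M[R]_(p, n)) : U *m V^T = 0 ->
  \det (col_mx U V *m (col_mx U V)^T) = \det (U *m U^T) * \det (V *m V^T).
Proof.
move=> UV; have VU : V *m U^T = 0 by rewrite -[V]trmxK -trmx_mul UV trmx0.
by rewrite tr_col_mx mul_col_row UV VU det_ublock.
Qed.

(** The coefficients solve the normal equations. *)
Lemma orthogonal_projection m n (V : 'M[R]_(m, n)) (v : 'rV[R]_n) :
  \det (V *m V^T) != 0 -> exists t, (v - t *m V) *m V^T = 0.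
Proof.
move=> dV; have uG : V *m V^T \in unitmx by rewrite unitmxE unitfE.
exists (v *m V^T *m invmx (V *m V^T)).
by rewrite mulmxBl -!mulmxA mulVmx// mulmx1 subrr.
Qed.

(** One Gram-Schmidt step per row: subtracting from the first row its projection onto the others has
    determinant 1 and makes the Gram matrix block diagonal. *)
Lemma det_gram_gt0 m n (V : 'M[R]_(m, n)) : row_free V -> 0 < \det (V *m V^T).
Proof.
elim: m V => [|m IH] V fV; first by rewrite det_mx00.
pose v := usubmx (V : 'M[R]_(1 + m, n)); pose W := dsubmx (V : 'M[R]_(1 + m, n)).
have VE : V = col_mx v W :> 'M[R]_(1 + m, n) by rewrite vsubmxK.
have inj (u : 'rV[R]_(1 + m)) : u *m col_mx v W = 0 -> u = 0.
  by rewrite -VE => uV; apply: (row_free_inj fV); rewrite uV mul0mx.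
have fW : row_free W.
  apply/inj_row_free => u uW; have := inj (row_mx 0 u).
  rewrite mul_row_col mul0mx add0r => /(_ uW) /eqP.
  by rewrite -row_mx0 => /eqP/eq_row_mx[].
have dW := IH _ fW.
have [t tW] := orthogonal_projection v (lt0r_neq0 dW).
have w0 : v - t *m W != 0.
  apply/eqP => w0; have := inj (row_mx 1%:M (- t)).
  rewrite mul_row_col mul1mx mulNmx w0 => /(_ erefl) /eqP.
  rewrite -row_mx0 => /eqP/eq_row_mx[/matrixP/(_ 0 0)].
  by rewrite !mxE eqxx => /eqP; rewrite oner_eq0.
pose L : 'M[R]_(1 + m) := block_mx 1%:M (- t) 0 1%:M.
have LV : L *m col_mx v W = col_mx (v - t *m W) W.
  by rewrite mul_block_col !mul1mx mul0mx mulNmx add0r.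
have dL : \det L = 1 by rewrite det_ublock !det1 mulr1.
have -> : \det (V *m V^T) = \det ((L *m col_mx v W) *m (L *m col_mx v W)^T).
  by rewrite trmx_mul mulmxA -(mulmxA L) !det_mulmx det_tr dL mul1r mulr1 -VE.
rewrite LV det_gram_col_mx// mulr_gt0// [_ *m _^T]mx11_scalar det_scalar1.
exact: row_dot_gt0.
Qed.

Lemma row_free_gram m n (V : 'M[R]_(m, n)) : \det (V *m V^T) != 0 -> row_free V.
Proof.
move=> dV; apply/inj_row_free => u uV.
have uG : V *m V^T \in unitmx by rewrite unitmxE unitfE.
by rewrite -[u](mulmxK uG) mulmxA uV !mul0mx.
Qed.

End gram_matrices.

Section subspaces.
Context {R : realType} {n : nat}.
Implicit Types (E H : {vspace 'rV[R]_n}).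

Definition basis_mx E : 'M[R]_(\dim E, n) := \matrix_(i < \dim E) (vbasis E)`_i.

Lemma mul_basis_mx E (t : 'rV[R]_(\dim E)) :
  t *m basis_mx E = \sum_(i < \dim E) t 0 i *: (vbasis E)`_i.
Proof. by rewrite mulmx_sum_row; apply: eq_bigr => i _; rewrite rowK. Qed.

Lemma memv_basis_mx E (v : 'rV[R]_n) : (v \in E) = (v <= basis_mx E)%MS.
Proof.
apply/idP/submxP => [vE|[t ->]].
  exists (\row_i coord (vbasis E) i v); rewrite mul_basis_mx {1}(coord_vbasis vE).
  by apply: eq_bigr => i _; rewrite mxE.
rewrite mul_basis_mx; apply: memv_suml => i _; apply: memvZ.
by apply: vbasis_mem; rewrite mem_nth// size_tuple.
Qed.

Lemma row_free_basis_mx E : row_free (basis_mx E).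
Proof.
apply/inj_row_free => t; rewrite mul_basis_mx => t0.
have /andP[_ /freeP fb] := vbasisP E.
by apply/rowP => i; rewrite mxE; exact: (fb (fun i => t 0 i)).
Qed.

Lemma gramE E : gram E = basis_mx E *m (basis_mx E)^T.
Proof.
apply/matrixP => i j; rewrite !mxE /dot mxE; apply: eq_bigr => l _.
by rewrite !mxE.
Qed.

Definition complement_mx E := row_base (kermx (basis_mx E)^T).

Lemma row_free_complement_mx E : row_free (complement_mx E).
Proof. exact: row_base_free. Qed.

Lemma rank_complement E : \rank (kermx (basis_mx E)^T) = (n - \dim E)%N.
Proof.
rewrite mxrank_ker mxrank_tr; congr (_ - _)%N.
by apply/eqP; exact: row_free_basis_mx.
Qed.

Lemma orthogonal_complementP E (u : 'rV[R]_n) :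
  orthogonal_complement E u <-> u *m (basis_mx E)^T = 0.
Proof.
split => [uE|uE v].
  apply/rowP => i; rewrite [RHS]mxE.
  have iE : (vbasis E)`_i \in E by apply: vbasis_mem; rewrite mem_nth// size_tuple.
  by rewrite -(uE _ iE) /dot !mxE; apply: eq_bigr => l _; rewrite !mxE.
rewrite memv_basis_mx => /submxP[t ->].
by rewrite /dot trmx_mul mulmxA uE mul0mx mxE.
Qed.

Lemma complement_mxP E (u : 'rV[R]_n) :
  (u <= complement_mx E)%MS <-> orthogonal_complement E u.
Proof.
rewrite orthogonal_complementP eq_row_base; split; first by move=> /sub_kermxP.
by move=> h; apply/sub_kermxP.
Qed.

Lemma complement_mx_orthogonal E : complement_mx E *m (basis_mx E)^T = 0.
Proof. by apply/sub_kermxP; rewrite eq_row_base. Qed.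

Lemma basis_mx_orthogonal E : basis_mx E *m (complement_mx E)^T = 0.
Proof. by apply: trmx_inj; rewrite trmx_mul trmxK trmx0 complement_mx_orthogonal. Qed.

Lemma basis_mx_det_neq0 E : \det (basis_mx E *m (basis_mx E)^T) != 0.
Proof. by apply: lt0r_neq0; apply: det_gram_gt0; exact: row_free_basis_mx. Qed.

Lemma complement_mx_det_neq0 E : \det (complement_mx E *m (complement_mx E)^T) != 0.
Proof. by apply: lt0r_neq0; apply: det_gram_gt0; exact: row_free_complement_mx. Qed.

(** The residual of the projection of [u] onto E is in the complement of E and orthogonal to it,
    hence orthogonal to itself. *)
Lemma biorthogonal E (u : 'rV[R]_n) : u *m (complement_mx E)^T = 0 -> u \in E.
Proof.
move=> uA; have [t ht] := orthogonal_projection u (basis_mx_det_neq0 E).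
suff w0 : u - t *m basis_mx E = 0.
  by rewrite memv_basis_mx -(subrK (t *m basis_mx E) u) w0 add0r submxMl.
have [x wx] : exists x, u - t *m basis_mx E = x *m complement_mx E.
  by apply/submxP/complement_mxP/orthogonal_complementP.
apply: row_dot_eq0; rewrite [in X in _ *m X]wx trmx_mul mulmxA mulmxBl uA -mulmxA.
by rewrite basis_mx_orthogonal mulmx0 subrr mul0mx.
Qed.

Context (E H : {vspace 'rV[R]_n}).
Hypothesis HperpE : orthogonal_complement H `<=` [set` E].
Let A := complement_mx H.
Let B := basis_mx (E :&: H)%VS.
Let C := complement_mx E.

Lemma complement_mx_sub (u : 'rV[R]_n) : (u <= A)%MS -> u \in E.
Proof. by move=> /complement_mxP/HperpE. Qed.

Lemma complement_mx_sub_dual (u : 'rV[R]_n) : (u <= C)%MS -> u \in H.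
Proof.
move=> uC; apply: biorthogonal.
have /complement_mxP/orthogonal_complementP uE := uC.
have /submxP[D AE] : (A <= basis_mx E)%MS.
  by apply/row_subP => i; rewrite -memv_basis_mx complement_mx_sub// row_sub.
by rewrite -/A AE trmx_mul mulmxA uE mul0mx.
Qed.

Lemma complement_cap_orthogonal : A *m B^T = 0.
Proof.
have /submxP[D ->] : (B <= basis_mx H)%MS.
  apply/row_subP => i; rewrite -memv_basis_mx.
  have : row i B \in (E :&: H)%VS by rewrite memv_basis_mx row_sub.
  by rewrite memv_cap => /andP[].
by rewrite trmx_mul mulmxA complement_mx_orthogonal mul0mx.
Qed.

Lemma cap_complement_orthogonal : B *m C^T = 0.
Proof.
have /submxP[D ->] : (B <= basis_mx E)%MS.
  apply/row_subP => i; rewrite -memv_basis_mx.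
  have : row i B \in (E :&: H)%VS by rewrite memv_basis_mx row_sub.
  by rewrite memv_cap => /andP[].
by rewrite -mulmxA basis_mx_orthogonal mulmx0.
Qed.

Lemma complements_orthogonal : A *m C^T = 0.
Proof.
have /submxP[D ->] : (A <= basis_mx E)%MS.
  by apply/row_subP => i; rewrite -memv_basis_mx complement_mx_sub// row_sub.
by rewrite -mulmxA basis_mx_orthogonal mulmx0.
Qed.

Lemma memv_cap_submx (v : 'rV[R]_n) : v \in E -> v \in H -> (v <= B)%MS.
Proof. by move=> vE vH; rewrite -memv_basis_mx memv_cap vE. Qed.

(** Subtracting the projection onto H^perp puts [v] into H and, as H^perp lies in E, keeps it in
    E. *)
Lemma memv_complement_cap (v : 'rV[R]_n) : v \in E -> (v <= col_mx A B)%MS.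
Proof.
move=> vE; have [t ht] := orthogonal_projection v (complement_mx_det_neq0 H).
rewrite -addsmxE -(subrK (t *m A) v) addrC.
apply: addmx_sub_adds; first exact: submxMl.
apply: memv_cap_submx; last exact: biorthogonal.
by rewrite rpredB// complement_mx_sub// submxMl.
Qed.

Lemma memv_cap_complement (v : 'rV[R]_n) : v \in H -> (v <= col_mx B C)%MS.
Proof.
move=> vH; have [t ht] := orthogonal_projection v (complement_mx_det_neq0 E).
rewrite -addsmxE -(subrK (t *m C) v).
apply: addmx_sub_adds; last exact: submxMl.
apply: memv_cap_submx; first exact: biorthogonal.
by rewrite rpredB// complement_mx_sub_dual// submxMl.
Qed.

Lemma basis_mx_sub_complement_cap : (basis_mx E <= col_mx A B)%MS.
Proof. by apply/row_subP => i; apply: memv_complement_cap; rewrite memv_basis_mx row_sub. Qed.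

Lemma basis_mx_sub_cap_complement : (basis_mx H <= col_mx B C)%MS.
Proof. by apply/row_subP => i; apply: memv_cap_complement; rewrite memv_basis_mx row_sub. Qed.

Lemma complement_cap_sub_basis_mx : (col_mx A B <= basis_mx E)%MS.
Proof.
rewrite col_mx_sub; apply/andP; split; apply/row_subP => i; rewrite -memv_basis_mx.
  by rewrite complement_mx_sub// row_sub.
have : row i B \in (E :&: H)%VS by rewrite memv_basis_mx row_sub.
by rewrite memv_cap => /andP[].
Qed.

Lemma cap_complement_sub_basis_mx : (col_mx B C <= basis_mx H)%MS.
Proof.
rewrite col_mx_sub; apply/andP; split; apply/row_subP => i; rewrite -memv_basis_mx.
  have : row i B \in (E :&: H)%VS by rewrite memv_basis_mx row_sub.
  by rewrite memv_cap => /andP[].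
by rewrite complement_mx_sub_dual// row_sub.
Qed.

Lemma row_full_orthogonal_sum : row_full (col_mx (col_mx A B) C).
Proof.
rewrite -sub1mx; apply/row_subP => i; move: (row i _) => v.
have [t ht] := orthogonal_projection v (complement_mx_det_neq0 E).
rewrite -addsmxE -(subrK (t *m C) v); apply: addmx_sub_adds; last exact: submxMl.
by apply: memv_complement_cap; exact: biorthogonal.
Qed.

Lemma complement_cap_complement_orthogonal : col_mx A B *m C^T = 0.
Proof. by rewrite mul_col_mx complements_orthogonal cap_complement_orthogonal col_mx0. Qed.

End subspaces.

(** * Integrals in coordinates through Borel minorants *)

Section integrals.
Local Open Scope ereal_scope.
Context {R : realType}.
Notation T n := (n.-tuple (measurableTypeR R)).
Notation mu n := (@borel_lebesgue R n).

Definition borel_minorant n (g : 'rV[R]_n -> \bar R) (s : T n -> \bar R) :=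
  [/\ measurable_fun [set: T n] s, forall t, 0 <= s t & forall t, s t <= g (row_of_tuple t)].

Lemma integralRn_le n (g : 'rV[R]_n -> \bar R) (K : \bar R) : (forall x, 0 <= g x) ->
  (forall s, borel_minorant g s -> \int[mu n]_t s t <= K) -> integralRn g <= K.
Proof.
move=> g0 H; apply: (@completed_integral_le _ _ _ (mu n) (sigma_finiteT (mu n))) => //.
by move=> s ms s0 sg; apply: H.
Qed.

Lemma integralRn_gt n (g : 'rV[R]_n -> \bar R) (K : \bar R) : (forall x, 0 <= g x) ->
  K < integralRn g -> exists2 s, borel_minorant g s & K < \int[mu n]_t s t.
Proof.
move=> g0 Kg; apply: contrapT => H; move: Kg; apply/negP; rewrite -leNgt.
apply: integralRn_le => // s sg; rewrite leNgt; apply/negP => Ks; apply: H.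
by exists s.
Qed.

Lemma le_integralRn n (g : 'rV[R]_n -> \bar R) (s : T n -> \bar R) :
  borel_minorant g s -> \int[mu n]_t s t <= integralRn g.
Proof. by move=> [ms s0 sg]; exact: le_completed_integral. Qed.

Lemma integralRn_ge0 n (g : 'rV[R]_n -> \bar R) : (forall x, 0 <= g x) ->
  0 <= integralRn g.
Proof. by move=> g0; exact: integral_ge0. Qed.

Lemma integrableRn_majorant n (f : 'rV[R]_n -> R) : (forall x, 0 <= f x)%R ->
  integrableRn f ->
  exists g : T n -> \bar R, [/\ measurable_fun [set: T n] g,
    forall t, (f (row_of_tuple t))%:E <= g t &
    \int[mu n]_t g t <= integralRn (fun x => (f x)%:E)].
Proof.
move=> f0 /integrableP[/measurable_EFinP mf _].
apply: measurable_majorant => //; exact: sigma_finiteT.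
Qed.

(** As [g] may not be measurable, Borel minorants of the pulled-back function are transported by
    [invmx Q] to Borel minorants of [g]. *)
Lemma integralRn_mulmx n (Q : 'M[R]_n) (g : 'rV[R]_n -> \bar R) : Q \in unitmx ->
  (forall x, 0 <= g x) ->
  `|\det Q|%:E * integralRn (fun x => g (x *m Q)) <= integralRn g.
Proof.
move=> uQ g0; have dQ : (0 < `|\det Q|)%R by rewrite normr_gt0 -unitfE -unitmxE.
rewrite muleC -lee_pdivlMr//.
apply: integralRn_le => // s [ms s0 sg]; rewrite lee_pdivlMr//.
have uQ' : invmx Q \in unitmx by rewrite unitmx_inv.
rewrite -(ge0_integral_tuple_mulmx uQ' ms s0) det_inv normfV muleC muleA.
rewrite -EFinM divff ?gt_eqF// mul1e; apply: le_integralRn; split => //.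
- exact: (measurableT_comp ms (measurable_tuple_mulmx _)).
- move=> t; apply: le_trans (sg _) _.
  by rewrite row_of_tuple_mulmx mulmxKV.
Qed.

(** If [V = Q *m W], the Gram determinant acquires the factor [(\det Q) ^+ 2], whose square root is
    the Jacobian of the change of coordinates. *)
Lemma integralRn_change_basis m p n (V : 'M[R]_(m, n)) (W : 'M[R]_(p, n))
    (g : 'rV[R]_n -> \bar R) : row_free V -> row_free W -> (V :=: W)%MS ->
  (forall x, 0 <= g x) ->
  (Num.sqrt (\det (V *m V^T)))%:E * integralRn (fun t => g (t *m V)) <=
  (Num.sqrt (\det (W *m W^T)))%:E * integralRn (fun t => g (t *m W)).
Proof.
move=> fV fW VW g0; have mp : m = p.
  have rVW : \rank V = \rank W by apply/eqP; rewrite eqn_leq !mxrankS// VW.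
  by move: rVW; rewrite (eqP fV) (eqP fW).
subst p; have /submxP[Q VE] : (V <= W)%MS by rewrite VW.
have uQ : Q \in unitmx.
  rewrite -row_free_unit; apply/inj_row_free => u uQ.
  by apply: (row_free_inj fV); rewrite VE mulmxA uQ !mul0mx.
have -> : V *m V^T = Q *m (W *m W^T) *m Q^T by rewrite VE trmx_mul !mulmxA.
rewrite !det_mulmx det_tr mulrAC -expr2 sqrtrM ?sqr_ge0// sqrtr_sqr.
rewrite EFinM -muleA muleCA; apply: lee_wpmul2l; first by rewrite lee_fin sqrtr_ge0.
have -> : (fun t => g (t *m V)) = (fun t => g (t *m Q *m W)).
  by apply/funext => t; rewrite VE mulmxA.
exact: (@integralRn_mulmx _ Q (fun t => g (t *m W))).
Qed.

Lemma integral_tuple_mulmx_full p n (W : 'M[R]_(p, n)) (g : T n -> \bar R) :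
  row_free W -> row_full W -> measurable_fun [set: T n] g -> (forall t, 0 <= g t) ->
  (Num.sqrt (\det (W *m W^T)))%:E * \int[mu p]_t g (tuple_mulmx W t) = \int[mu n]_t g t.
Proof.
move=> fW fullW mg g0; have pn : p = n.
  by move: (eqP fW); rewrite (eqP fullW).
subst p; rewrite det_mulmx det_tr -expr2 sqrtr_sqr.
by apply: ge0_integral_tuple_mulmx => //; rewrite -row_free_unit.
Qed.

Lemma row_of_tuple_cat p q (x : T p) (y : T q) :
  row_of_tuple (tuple_cat (x, y)) = row_mx (row_of_tuple x) (row_of_tuple y).
Proof.
apply/rowP => i; rewrite mxE; case: (splitP i) => j ij.
  have -> : i = lshift q j by exact: val_inj.
  by rewrite (row_mxEl _ _ 0%R j) mxE tnth_lshift.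
have -> : i = rshift p j by exact: val_inj.
by rewrite (row_mxEr _ _ 0%R j) mxE tnth_rshift.
Qed.

Lemma row_of_tuple_conv n (l : R) (x y : T n) :
  row_of_tuple (tuple_conv l x y) =
  ((1 - l) *: row_of_tuple x + l *: row_of_tuple y)%R.
Proof. by apply/rowP => i; rewrite !mxE tnth_mktuple. Qed.

Lemma row_of_zero_tuple n : row_of_tuple (zero_tuple n) = 0%R :> 'rV[R]_n.
Proof. by apply/rowP => i; rewrite !mxE tnth_mktuple. Qed.

End integrals.

(** * The inequality in coordinates along three summands *)

Section orthogonal_coordinates.
Local Open Scope ereal_scope.
Context {R : realType} {n : nat}.
Notation RR := (measurableTypeR R).
Notation T n := (n.-tuple (measurableTypeR R)).
Notation mu n := (@borel_lebesgue R n).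

Lemma affine_paramE (x0 : 'rV[R]_n) (E : {vspace 'rV[R]_n}) (t : 'rV[R]_(\dim E)) :
  affine_param x0 t = (x0 + t *m basis_mx E)%R.
Proof. by rewrite /affine_param mul_basis_mx. Qed.

Lemma projection_ge0 (f : 'rV[R]_n -> R) (E : {vspace 'rV[R]_n}) (x : 'rV[R]_n) :
  (forall x, 0 <= f x)%R -> 0 <= projection f E x.
Proof.
move=> f0; apply: (@le_trans _ _ (f x)%:E); first by rewrite lee_fin.
apply: ereal_sup_ubound; exists x => //= v _.
by rewrite subrr /dot mul0mx mxE.
Qed.

Lemma tuple_section_minorant p q (g : 'rV[R]_(p + q) -> \bar R) (s : T (p + q) -> \bar R) :
  borel_minorant g s ->
  [/\ measurable_fun [set: T p * T q] (s \o @tuple_cat R p q),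
      forall z, 0 <= (s \o @tuple_cat R p q) z,
      forall x y, s (tuple_cat (x, y)) <= g (row_mx (row_of_tuple x) (row_of_tuple y)) &
      \int[mu (p + q)]_t s t = \int[mu p]_x \int[mu q]_y s (tuple_cat (x, y))].
Proof.
move=> [ms s0 sg]; split.
- by apply: (measurableT_comp ms); exact: measurable_tuple_cat.
- by move=> z; exact: s0.
- by move=> x y; rewrite -row_of_tuple_cat.
- exact: ge0_integral_tuple_cat.
Qed.

Context (a k c : nat) (A : 'M[R]_(a, n)) (B : 'M[R]_(k, n)) (C : 'M[R]_(c, n)).
Context (f : 'rV[R]_n -> R) (P : 'rV[R]_n -> \bar R) (M : \bar R).
Hypotheses (f_log_concave : log_concave f) (P0 : forall x, 0 <= P x)
  (c0 : (0 < c)%N).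
Hypothesis P_gt : forall x (t : R), t%:E < P x -> exists z, (t < f (x + z *m C))%R.
Hypothesis P_ge : forall x z, (f (x + z *m C))%:E <= P x.
Hypothesis M_ge : forall x : 'rV[R]_a, integralRn (fun b => P (x *m A + b *m B)%R) <= M.

(** Here [A], [B], [C] serve only as linear parametrisations; orthogonality and the volume factors
    of the bases are settled in the theorem. *)
Lemma orthogonal_coordinates_inequality (g : T n -> \bar R) :
  measurable_fun [set: T n] g -> (forall t, (f (row_of_tuple t))%:E <= g t) ->
  integralRn (fun t => P (t *m col_mx A B)) *
    integralRn (fun t => (f (t *m col_mx B C))%:E) <=
  ('C(a + c, a)%:R)%:E * M *
    \int[mu (a + k + c)]_t g (tuple_mulmx (col_mx (col_mx A B) C) t).
Proof.
move=> mg fg; have [f0 f_conc] := f_log_concave.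
have fE0 x : 0 <= (f x)%:E by rewrite lee_fin.
have g0 t : 0 <= g t by exact: le_trans (fE0 _) (fg t).
set W := col_mx (col_mx A B) C; pose F t := g (tuple_mulmx W t).
have mF : measurable_fun [set: T (a + k + c)] F.
  exact: (measurableT_comp mg (measurable_tuple_mulmx _)).
have F0 t : 0 <= F t by exact: g0.
have M0 : 0 <= M by apply: le_trans (M_ge 0); exact: integralRn_ge0.
have RHS0 : 0 <= ('C(a + c, a)%:R)%:E * M * \int[mu (a + k + c)]_t F t.
  by rewrite mule_ge0// ?mule_ge0// ?lee_fin ?ler0n//; exact: integral_ge0.
(* Each integral on the left is approached from below by integrals of Borel minorants, so it
   suffices to bound the product for every pair of them. *)
suff main s r : borel_minorant (fun t => P (t *m col_mx A B)) s ->
    borel_minorant (fun t => (f (t *m col_mx B C))%:E) r ->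
    (\int[mu (a + k)]_t s t) * (\int[mu (k + c)]_t r t) <=
    ('C(a + c, a)%:R)%:E * M * \int[mu (a + k + c)]_t F t.
  apply: mule_le_of_real => //; [exact: integralRn_ge0|exact: integralRn_ge0|].
  move=> t t0 /(integralRn_gt (fun x => P0 _))[s sP ts]; rewrite muleC.
  apply: mule_le_of_real => //; [exact: integralRn_ge0|by rewrite lee_fin ltW|].
  move=> u u0 /(integralRn_gt (fun x => fE0 _))[r rf ur].
  apply: le_trans (main _ _ sP rf); rewrite muleC.
  by apply: lee_pmul; rewrite ?lee_fin ?ltW.
move=> sP rf.
have [ms s0 sle ->] := tuple_section_minorant sP.
have [mr r0 rle ->] := tuple_section_minorant rf.
pose cat3 (q : (T a * T k) * T c) := tuple_cat (tuple_cat q.1, q.2).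
have mcat3 : measurable_fun setT cat3.
  apply: (measurableT_comp (@measurable_tuple_cat R (a + k) c)).
  apply: measurable_fun_pair; last exact: measurable_snd.
  by apply: (measurableT_comp (@measurable_tuple_cat R a k)); exact: measurable_fst.
have mF3 := measurableT_comp mF mcat3.
have -> : \int[mu (a + k + c)]_t F t =
    \int[mu a]_x \int[mu k]_b \int[mu c]_z (F \o cat3) ((x, b), z).
  rewrite ge0_integral_tuple_cat// ge0_integral_tuple_cat//.
  - apply: (measurable_fun_fubini_tonelli_F (F \o @tuple_cat R (a + k) c)).
      by apply: (measurableT_comp mF); exact: measurable_tuple_cat.
    by move=> x; exact: F0.
  - by move=> x; exact: integral_ge0.
have Fge x b z : (f (row_of_tuple x *m A + row_of_tuple b *m B + row_of_tuple z *m C))%:E <=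
    (F \o cat3) ((x, b), z).
  apply: le_trans (fg _); rewrite lee_fin row_of_tuple_mulmx !row_of_tuple_cat.
  by rewrite !mul_row_col.
apply: (sections_projections_borel c0 mF3 ms mr) => //.
- by move=> q; exact: F0.
- move=> x b1 t1 t10 ts.
  have {ts}tP : t1%:E < P (row_of_tuple x *m A + row_of_tuple b1 *m B)%R.
    by apply: (lt_le_trans ts); apply: (le_trans (sle _ _)); rewrite mul_row_col.
  have [z1 tf] := P_gt tP.
  exists (tuple_of_row z1) => l b0 z0 t0 /andP[l0 l1] t00 tr.
  have t0f : (t0 < f (row_of_tuple b0 *m B + row_of_tuple z0 *m C))%R.
    rewrite -lte_fin; apply: (lt_le_trans tr); apply: (le_trans (rle _ _)).
    by rewrite mul_row_col.
  apply: lt_le_trans (Fge _ _ _); rewrite lte_fin.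
  have l01 : (0 <= l <= 1)%R by rewrite !ltW.
  have := f_conc (row_of_tuple b0 *m B + row_of_tuple z0 *m C)%R
    (row_of_tuple x *m A + row_of_tuple b1 *m B + z1 *m C)%R l l01.
  rewrite !row_of_tuple_conv row_of_zero_tuple tuple_of_rowK scaler0 add0r.
  (* The first point has no component along [A], so the combination has [A]-coordinate [l] times
     that of the second. *)
  have -> : ((1 - l) *: (row_of_tuple b0 *m B + row_of_tuple z0 *m C) +
      l *: (row_of_tuple x *m A + row_of_tuple b1 *m B + z1 *m C) =
      l *: row_of_tuple x *m A +
      ((1 - l) *: row_of_tuple b0 + l *: row_of_tuple b1) *m B +
      ((1 - l) *: row_of_tuple z0 + l *: z1) *m C)%R.
    rewrite !mulmxDl -!scalemxAl !scalerDr.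
    by rewrite [LHS](AC (2*3)%AC (3*(1*4)*(2*5))%AC).
  apply: lt_le_trans; apply: ltr_pM.
  + by rewrite powR_ge0.
  + by rewrite powR_ge0.
  + by apply: gt0_ltr_powR; rewrite ?subr_gt0// nnegrE ltW// (lt_trans t00).
  + by apply: gt0_ltr_powR; rewrite ?subr_gt0// nnegrE ltW// (lt_trans t10).
- move=> x; apply: le_trans (M_ge (row_of_tuple x)); apply: le_integralRn; split.
  + exact: (measurableT_comp ms (measurable_pair1 x)).
  + by move=> b; exact: s0.
  + by move=> b; apply: le_trans (sle _ _) _; rewrite mul_row_col.
(* On the fibre over [b], [r] is below [f], hence below the value of [P]; the case [x = 0] of [M_ge]
   therefore bounds [p]. *)
- move=> p mp p0 pr; apply: le_trans (M_ge 0); apply: le_integralRn; split => // b.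
  rewrite mul0mx add0r leNgt; apply/negP => Pp.
  have Pfin : P (row_of_tuple b *m B)%R \is a fin_num.
    by rewrite ge0_fin_numE// (lt_le_trans Pp)// leey.
  move: Pp; rewrite -(fineK Pfin) => /lte_dense_real[t Pt tp].
  have t0 : (0 < t)%R by apply: le_lt_trans Pt; exact: fine_ge0.
  have [z tr] := pr _ _ t0 tp.
  move: Pt; apply/negP; rewrite -leNgt -lee_fin fineK//.
  apply: (le_trans (ltW tr)); apply: (le_trans (rle _ _)).
  by rewrite mul_row_col.
Qed.

End orthogonal_coordinates.

Theorem theorem1p8 (R : realType) (n i j : nat) (f : 'rV[R]_n -> R)
    (H E : {vspace 'rV[R]_n})
    (f_log_concave : log_concave f) (f_integrable : integrableRn f)
    (dimH : \dim H = i) (dimE : \dim E = j)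
    (i_range : (2 <= i <= n.-1)%N) (j_range : (2 <= j <= n.-1)%N)
    (ij : (n + 1 <= i + j)%N)
    (HperpE : orthogonal_complement H `<=` [set` E]) :
  let k := (i + j - n)%N in
  (integral_affine 0%R E (projection f E) *
     integral_affine 0%R H (fun y => (f y)%:E)
   <= (('C(n - k, n - i)%N)%:R)%:E *
      ereal_sup [set integral_affine x0 (E :&: H)%VS (projection f E)
                | x0 in orthogonal_complement H] *
      integralRn (fun z => (f z)%:E))%E.
Proof.
cbv zeta.
have nj : (0 < n - j)%N by move: j_range; clear; lia.
have codims : (n - (i + j - n) = (n - i) + (n - j))%N.
  by move: i_range j_range ij; clear; lia.
have [f0 _] := f_log_concave.
set A := complement_mx H; set B := basis_mx (E :&: H)%VS; set C := complement_mx E.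
set P := projection f E; set S := ereal_sup _.
have P0 x : (0 <= P x)%E by exact: projection_ge0.
have fE0 x : (0 <= (f x)%:E)%E by rewrite lee_fin.
have gA : 0 < \det (A *m A^T) by apply: det_gram_gt0; exact: row_free_complement_mx.
have gB : 0 < \det (B *m B^T) by apply: det_gram_gt0; exact: row_free_basis_mx.
have gC : 0 < \det (C *m C^T) by apply: det_gram_gt0; exact: row_free_complement_mx.
have AB : \det (col_mx A B *m (col_mx A B)^T) = \det (A *m A^T) * \det (B *m B^T).
  by apply: det_gram_col_mx; exact: complement_cap_orthogonal.
have BC : \det (col_mx B C *m (col_mx B C)^T) = \det (B *m B^T) * \det (C *m C^T).
  by apply: det_gram_col_mx; exact: cap_complement_orthogonal.
have ABC : \det (col_mx (col_mx A B) C *m (col_mx (col_mx A B) C)^T) =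
    \det (A *m A^T) * \det (B *m B^T) * \det (C *m C^T).
  by rewrite det_gram_col_mx ?AB//; exact: complement_cap_complement_orthogonal.
have fAB : row_free (col_mx A B).
  by apply: row_free_gram; rewrite AB mulf_neq0// gt_eqF.
have fBC : row_free (col_mx B C).
  by apply: row_free_gram; rewrite BC mulf_neq0// gt_eqF.
have fABC : row_free (col_mx (col_mx A B) C).
  by apply: row_free_gram; rewrite ABC !mulf_neq0// gt_eqF.
have eqE : (basis_mx E :=: col_mx A B)%MS.
  by apply/eqmxP; rewrite basis_mx_sub_complement_cap// complement_cap_sub_basis_mx.
have eqH : (basis_mx H :=: col_mx B C)%MS.
  by apply/eqmxP; rewrite basis_mx_sub_cap_complement// cap_complement_sub_basis_mx.
(* The bases need not be orthonormal. As the summands are orthogonal, the volume factors of E, H and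
   R^n are [sA * sB], [sB * sC] and [sA * sB * sC]. *)
set sA := Num.sqrt (\det (A *m A^T)); set sB := Num.sqrt (\det (B *m B^T)).
set sC := Num.sqrt (\det (C *m C^T)).
have sB0 : 0 < sB by rewrite sqrtr_gt0.
have sAB : sA * sB = Num.sqrt (\det (col_mx A B *m (col_mx A B)^T)).
  by rewrite AB sqrtrM// ltW.
have sBC : sB * sC = Num.sqrt (\det (col_mx B C *m (col_mx B C)^T)).
  by rewrite BC sqrtrM// ltW.
have leE : (integral_affine 0 E P <=
    (sA * sB)%:E * integralRn (fun t => P (t *m col_mx A B)))%E.
  rewrite /integral_affine gramE sAB.
  have -> : (fun t => P (affine_param 0 t)) = (fun t => P (t *m basis_mx E)).
    by apply/funext => t; rewrite affine_paramE add0r.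
  by apply: integralRn_change_basis => //; exact: row_free_basis_mx.
have leH : (integral_affine 0 H (fun y => (f y)%:E) <=
    (sB * sC)%:E * integralRn (fun t => (f (t *m col_mx B C))%:E))%E.
  rewrite /integral_affine gramE sBC.
  have -> : (fun t => (f (affine_param 0 t))%:E) = (fun t => (f (t *m basis_mx H))%:E).
    by apply/funext => t; rewrite affine_paramE add0r.
  by apply: (@integralRn_change_basis _ _ _ _ _ _ (fun y => (f y)%:E)) => //;
    exact: row_free_basis_mx.
have [g [mg fg gf]] := integrableRn_majorant f0 f_integrable.
have g0 t : (0 <= g t)%E by exact: le_trans (fg t).
have c0 : (0 < \rank (kermx (basis_mx E)^T))%N by rewrite rank_complement dimE.
(* Integrals over translates of [E :&: H] carry the factor [sB]; dividing by it bounds the bare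
   coordinate integrals, and it later cancels the second [sB] coming from the left side. *)
pose M := (S * (sB^-1)%:E)%E.
have P_gt x (t : R) : (t%:E < P x)%E -> exists z, t < f (x + z *m C).
  move=> /ereal_sup_gt[_ [y yE <-]]; rewrite lte_fin => ty.
  have /complement_mxP/submxP[z yz] := yE.
  by exists z; rewrite -yz addrC subrK.
have P_ge x z : ((f (x + z *m C))%:E <= P x)%E.
  apply: ereal_sup_ubound; exists (x + z *m C) => //=.
  by rewrite addrAC subrr add0r; apply/complement_mxP; exact: submxMl.
have M_ge (x : 'rV[R]_(\rank (kermx (basis_mx H)^T))) :
    (integralRn (fun b => P (x *m A + b *m B)%R) <= M)%E.
  rewrite /M lee_pdivlMr// muleC; apply: ereal_sup_ubound.
  exists (x *m A); first by apply/complement_mxP; exact: submxMl.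
  rewrite /integral_affine gramE; congr (_ * integralRn _)%E.
  by apply/funext => t; rewrite affine_paramE.
have main := orthogonal_coordinates_inequality f_log_concave P0 c0 P_gt P_ge M_ge mg fg.
have full := integral_tuple_mulmx_full fABC (row_full_orthogonal_sum HperpE) mg g0.
set I1 := integralRn _ in leE main; set I2 := integralRn _ in leH main.
set X := (\int[_]_t _)%E in main full.
have S0 : (0 <= S)%E.
  have : (0 <= M)%E by apply: le_trans (M_ge 0); exact: integralRn_ge0.
  by rewrite /M pmule_lge0// lte_fin invr_gt0.
have I10 : (0 <= I1)%E by exact: integralRn_ge0.
have I20 : (0 <= I2)%E by exact: integralRn_ge0.
have affine_ge0 x0 (F : {vspace 'rV[R]_n}) h : (forall x, 0 <= h x)%E ->
    (0 <= integral_affine x0 F h)%E.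
  by move=> h0; rewrite mule_ge0 ?lee_fin ?sqrtr_ge0//; exact: integralRn_ge0.
apply: le_trans (lee_pmul (affine_ge0 _ _ _ P0) (affine_ge0 _ _ _ fE0) leE leH) _.
rewrite muleACA -EFinM; apply: le_trans (lee_wpmul2l _ main) _.
  by rewrite lee_fin !mulr_ge0// sqrtr_ge0.
(* With [k = i + j - n], the number [n - k] is the sum of the codimensions of H and E. *)
have -> : 'C(n - (i + j - n), n - i) =
    'C(\rank (kermx (basis_mx H)^T) + \rank (kermx (basis_mx E)^T),
       \rank (kermx (basis_mx H)^T)).
  by rewrite !rank_complement dimH dimE codims.
set b := _%:R%:E; rewrite /M.
have -> : ((sA * sB * (sB * sC))%:E * (b * (S * (sB^-1)%:E) * X) =
    b * S * ((sA * sB * sC)%:E * X))%E.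
  rewrite [LHS](mule.[AC (1*((1*2)*1)) ((2*3)*((1*4)*5))])%AC -EFinM.
  by congr (_ * (_%:E * _))%E; field; rewrite gt_eqF.
apply: lee_wpmul2l; first by rewrite mule_ge0// lee_fin ler0n.
apply: le_trans gf; rewrite -full ABC.
have -> : Num.sqrt (\det (A *m A^T) * \det (B *m B^T) * \det (C *m C^T)) = sA * sB * sC.
  by rewrite sqrtrM ?mulr_ge0 ?ltW// sqrtrM// ltW.
exact: lexx.
Qed.
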